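(* (a) Fix $n>0$ and suppose $A\subseteq\mathbb{Z}^n$ is definable in $(\mathbb{Z},+,<,0)$. Then either $A$ is definable in $(\mathbb{Z},+,0)$ or the ordering on $\mathbb{Z}$ is definable in $(\mathbb{Z},+,0,A)$, and thus every set definable in $(\mathbb{Z},+,<,0)$ is definable in $(\mathbb{Z},+,0,A)$. (b) Suppose $\mathcal{M}$ is a stable expansion of $(\mathbb{Z},+,0)$. If $A\subseteq\mathbb{Z}^n$ (for some $n>0$) is definable in both $\mathcal{M}$ and $(\mathbb{Z},+,<,0)$, then $A$ is definable in $(\mathbb{Z},+,0)$. (c) Suppose $\mathcal{M}$ is a dp-minimal (or even just strong) expansion of $(\mathbb{Z},+,0)$ which is not interdefinable with $(\mathbb{Z},+,<,0)$. If $A\subseteq\mathbb{Z}^n$ (for some $n>0$) is definable in both $\mathcal{M}$ and $(\mathbb{Z},+,<,0)$, then $A$ is definable in $(\mathbb{Z},+,0)$.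
   Context: Definability always means first-order definability with parameters from the underlying universe. Let $\mathcal{M}_1,\mathcal{M}_2$ be first-order structures with the same universe $M$, possibly in different languages. $\mathcal{M}_1$ is a reduct of $\mathcal{M}_2$ (equivalently, $\mathcal{M}_2$ is an expansion of $\mathcal{M}_1$) if, for all $n>0$, every subset of $M^n$ definable in $\mathcal{M}_1$ is definable in $\mathcal{M}_2$. They are interdefinable if each is a reduct of the other. For $A\subseteq\mathbb{Z}^n$, $(\mathbb{Z},+,0,A)$ is the expansion of $(\mathbb{Z},+,0)$ by an $n$-ary relation symbol interpreted as $A$. A structure is called stable, dp-minimal, or strong if its complete theory is, in the standard model-theoretic sense. Dp-minimal means of dp-rank $1$. A complete theory $T$ is strong if there is no inp-pattern of infinite depth, i.e. there do not exist formulas $\varphi_i(\bar{x},\bar{y}_i)$ and integers $k_i$ for $i<\omega$, and parameters $\bar{b}_{i,j}$ for $i,j<\omega$ in a model of $T$, such that for each $i$ the set $\{\varphi_i(\bar{x},\bar{b}_{i,j}):j<\omega\}$ is $k_i$-inconsistent, and for each $h\colon\omega\to\omega$ the set $\{\varphi_i(\bar{x},\bar{b}_{i,h(i)}):i<\omega\}$ is consistent. *)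

(* Defs.v *)
From mathcomp Require Import all_boot all_order all_algebra.
From mathcomp Require Import boolp classical_sets.

Set Implicit Arguments.
Unset Strict Implicit.
Unset Printing Implicit Defensive.

Import Order.TTheory GRing.Theory Num.Theory.

Local Open Scope classical_set_scope.

Record language := Language {
  fsym : Type;
  farity : fsym -> nat;
  rsym : Type;
  rarity : rsym -> nat }.

Record structure (L : language) (M : Type) := Structure {
  finterp : forall f : fsym L, (farity f).-tuple M -> M;
  rinterp : forall r : rsym L, set ((rarity r).-tuple M) }.

(* Terms and formulas whose free variables are among x_0, ..., x_(n-1). *)
Inductive term (L : language) (n : nat) : Type :=
| Var of 'I_n
| App (f : fsym L) of 'I_(farity f) -> term L n.

(* The remaining connectives are the usual classical abbreviations.  [FAll]
   binds the variable 0 of its body; variable i of [FAll phi] is variable i.+1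
   of [phi]. *)
Inductive formula (L : language) : nat -> Type :=
| FFalse n : formula L n
| FEq n : term L n -> term L n -> formula L n
| FRel n (r : rsym L) : ('I_(rarity r) -> term L n) -> formula L n
| FImp n : formula L n -> formula L n -> formula L n
| FAll n : formula L n.+1 -> formula L n.

Fixpoint eval L M (S : structure L M) n (e : n.-tuple M) (t : term L n) : M :=
  match t with
  | Var i => tnth e i
  | App f ts => finterp S [tuple eval S e (ts i) | i < farity f]
  end.

Fixpoint sat L M (S : structure L M) n (phi : formula L n) :
    n.-tuple M -> Prop :=
  match phi in formula _ n return n.-tuple M -> Prop with
  | FFalse _ => fun=> False
  | FEq _ t u => fun e => eval S e t = eval S e u
  | FRel _ r ts => fun e => rinterp S [tuple eval S e (ts i) | i < rarity r]
  | FImp _ phi psi => fun e => sat S phi e -> sat S psi e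
  | FAll _ phi => fun e => forall a : M, sat S phi [tuple of a :: e]
  end.

(* The set defined by phi(x, b), where phi(x, y) has its variables split as an
   n-tuple x followed by an m-tuple y. *)
Definition instance L M (S : structure L M) n m (phi : formula L (n + m))
    (b : m.-tuple M) : set (n.-tuple M) :=
  [set x : n.-tuple M | sat S phi [tuple of x ++ b]].

Definition definable L M (S : structure L M) n (A : set (n.-tuple M)) : Prop :=
  exists m (phi : formula L (n + m)) (b : m.-tuple M), A = instance S phi b.

Definition is_reduct L1 L2 M (S1 : structure L1 M) (S2 : structure L2 M) :=
  forall n (A : set (n.-tuple M)), 0 < n -> definable S1 A -> definable S2 A.

Definition is_expansion L1 L2 M (S1 : structure L1 M) (S2 : structure L2 M) :=
  is_reduct S2 S1.

Definition interdefinable L1 L2 M (S1 : structure L1 M)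
    (S2 : structure L2 M) :=
  is_reduct S1 S2 /\ is_reduct S2 S1.

Definition theory L M (S : structure L M) : set (formula L 0) :=
  [set phi | sat S phi [tuple]].

Definition is_model L (T : set (formula L 0)) M (S : structure L M) :=
  forall phi, T phi -> sat S phi [tuple].

(* A family of formulas with parameters in a model, given by the sets they
   define in that model, is consistent with its elementary diagram exactly when
   it is finitely satisfiable there. *)
Definition consistent (I : eqType) X (F : I -> set X) : Prop :=
  forall s : seq I, exists x, forall i, i \in s -> F i x.

(* Subfamilies are counted by indices, not by the sets F i. *)
Definition k_inconsistent (I : eqType) X (k : nat) (F : I -> set X) : Prop :=
  forall s : seq I, uniq s -> size s = k ->
    ~ exists x, forall i, i \in s -> F i x.

(* phi(a_i, b_j) holds iff i < j. *)
Definition order_property L (T : set (formula L 0)) n m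
    (phi : formula L (n + m)) : Prop :=
  exists (N : Type) (S : structure L N)
         (a : nat -> n.-tuple N) (b : nat -> m.-tuple N),
    is_model T S /\ forall i j, instance S phi (b j) (a i) <-> i < j.

Definition stable_theory L (T : set (formula L 0)) : Prop :=
  forall n m (phi : formula L (n + m)), ~ order_property T phi.

Definition infinite_inp_pattern L (T : set (formula L 0)) : Prop :=
  exists (n : nat) (m : nat -> nat)
         (phi : forall i, formula L (n + m i)) (k : nat -> nat)
         (N : Type) (S : structure L N) (b : forall i, nat -> (m i).-tuple N),
  [/\ is_model T S,
      forall i, k_inconsistent (k i) (fun j => instance S (phi i) (b i j)) &
      forall h : nat -> nat,
        consistent (fun i => instance S (phi i) (b i (h i)))].

Definition strong_theory L (T : set (formula L 0)) : Prop :=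
  ~ infinite_inp_pattern T.

(* An ict-pattern of depth k in a single variable: for every h, the formulas
   phi_i(x, b_(i, h i)) and ~ phi_i(x, b_(i, j)), j <> h i, are jointly
   consistent. *)
Definition ict_pattern L (T : set (formula L 0)) (k : nat) : Prop :=
  exists (m : 'I_k -> nat) (phi : forall i, formula L (1 + m i))
         (N : Type) (S : structure L N)
         (b : forall i, nat -> (m i).-tuple N),
  is_model T S /\
  forall h : 'I_k -> nat,
    consistent (fun p : 'I_k * nat =>
      if p.2 == h p.1 then instance S (phi p.1) (b p.1 p.2)
      else ~` instance S (phi p.1) (b p.1 p.2)).

Definition dp_rank_ge L (T : set (formula L 0)) (k : nat) : Prop :=
  ict_pattern T k.

Definition dp_minimal_theory L (T : set (formula L 0)) : Prop :=
  dp_rank_ge T 1 /\ ~ dp_rank_ge T 2.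

Definition stable L M (S : structure L M) := stable_theory (theory S).
Definition strong L M (S : structure L M) := strong_theory (theory S).
Definition dp_minimal L M (S : structure L M) := dp_minimal_theory (theory S).

Definition add_rsym (L : language) (n : nat) : language :=
  {| fsym := fsym L;
     farity := @farity L;
     rsym := option (rsym L);
     rarity := fun r => if r is Some r' then rarity r' else n |}.

Definition add_rel L M (S : structure L M) n (A : set (n.-tuple M)) :
    structure (add_rsym L n) M :=
  @Structure (add_rsym L n) M (finterp S)
    (fun r => match r return set ((@rarity (add_rsym L n) r).-tuple M) with
              | Some r' => rinterp S (r := r')
              | None => A
              end).

Inductive group_fsym := Zero | Add.

Definition group_language : language :=
  {| fsym := group_fsym;
     farity := fun f => if f is Add then 2 else 0;
     rsym := void;
     rarity := fun=> 0 |}.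

Local Open Scope ring_scope.

Definition Zgroup : structure group_language int :=
  @Structure group_language int
    (fun f => match f return (@farity group_language f).-tuple int -> int with
              | Zero => fun=> 0
              | Add => fun t => t`_0 + t`_1
              end)
    (fun r : void => match r with end).

Definition Zlt : set (2.-tuple int) := [set t | t`_0 < t`_1].

(* (Z, +, <, 0) *)
Definition Presburger := add_rel Zgroup Zlt.

(* Main.v *)
(* (a) By quantifier elimination A is a union of classes for finitely many
   affine inequalities and one congruence.  On a coset of multiples of the
   modulus, A is constant far inside each chamber of the hyperplane
   arrangement.  If all chambers of the coset agree, then A or its complement
   lies in finitely many parallel translates of the hyperplanes, where one
   inequality is settled, and induction applies.  Otherwise two chambers that
   disagree face each other across a flat with direction u: for a vector v
   crossing it, the set of t such that tv + Zu meets A in a cofinite set is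
   definable with A from addition alone, and it is eventually true at one end
   and eventually false at the other, hence the order is definable.

   (b) An order has the order property.

   (c) By (a) it remains to show that an expansion M of Presburger arithmetic
   that is not interdefinable with it has a pattern.  Suppose that a definable
   family of subsets of Z has arbitrarily large members with arbitrarily large
   gaps.  Expanding integers as a_0 + a_1 + ... with digits a_i in members of
   the family at rapidly decreasing scales, the digits can be prescribed
   independently; by compactness this gives an inp-pattern of infinite depth
   with pairwise disjoint rows in one variable, so also an ict-pattern of depth
   2.  If M has no pattern, the resulting uniform bounds make every definable
   function f(x, t) piecewise affine in t along residue classes, with boundedly
   many pieces and slopes, and then f is Presburger by induction on the number
   of variables. *)
Require Import Defs.
From mathcomp Require Import all_boot all_order all_algebra.
From mathcomp Require Import boolp classical_sets filter.
From mathcomp Require Import zify ring.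

Set Implicit Arguments.
Unset Strict Implicit.
Unset Printing Implicit Defensive.

Import Order.TTheory GRing.Theory Num.Theory.

(** * Definability over abstract contexts *)

Definition lift_ren n m (r : 'I_n -> 'I_m) (i : 'I_n.+1) : 'I_m.+1 :=
  if unlift ord0 i is Some j then lift ord0 (r j) else ord0.

Section Renaming.
Variable L : language.

Fixpoint trename n m (r : 'I_n -> 'I_m) (t : term L n) : term L m :=
  match t with
  | Var i => Var L (r i)
  | App f ts => App (fun i => trename r (ts i))
  end.

Fixpoint frename n (phi : formula L n) : forall m, ('I_n -> 'I_m) -> formula L m :=
  match phi in formula _ n return forall m, ('I_n -> 'I_m) -> formula L m with
  | FFalse _ => fun m _ => FFalse L m
  | FEq _ t u => fun m r => FEq (trename r t) (trename r u)
  | FRel _ R ts => fun m r => FRel (fun i => trename r (ts i))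
  | FImp _ phi psi => fun m r => FImp (frename phi r) (frename psi r)
  | FAll _ phi => fun m r => FAll (frename phi (lift_ren r))
  end.

Variables (M : Type) (S : structure L M).

Lemma eval_trename n m (r : 'I_n -> 'I_m) (t : term L n) (e : m.-tuple M) :
  eval S e (trename r t) = eval S [tuple tnth e (r i) | i < n] t.
Proof.
elim: t => [i|f ts IH] /=; first by rewrite tnth_mktuple.
by congr (finterp S); apply: eq_from_tnth => i; rewrite !tnth_mktuple IH.
Qed.

Lemma sat_frename n (phi : formula L n) m (r : 'I_n -> 'I_m) (e : m.-tuple M) :
  sat S (frename phi r) e = sat S phi [tuple tnth e (r i) | i < n].
Proof.
elim: phi m r e => {n} [n|n t u|n R ts|n phi IHphi psi IHpsi|n phi IH] m r e //=.
- by rewrite !eval_trename.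
- congr (rinterp S); apply: eq_from_tnth => i.
  by rewrite !tnth_mktuple eval_trename.
- by rewrite IHphi IHpsi.
- apply: eq_forall => a; rewrite IH; congr (sat S phi).
  apply: eq_from_tnth => i; rewrite tnth_mktuple /lift_ren.
  case: unliftP => [j ->|->]; last by rewrite !tnth0.
  by rewrite !tnthS tnth_mktuple.
Qed.

End Renaming.

(* A context is a type of assignments, given by its coordinate functions; a
   predicate on it is definable when it is a formula evaluated at coordinates
   and constants. *)
Class Ctx (X : Type) := vars : (X -> int) -> Prop.

#[export] Instance ctx_int : Ctx int := fun f => f = id.
#[export] Instance ctx_tuple n : Ctx (n.-tuple int) :=
  fun f => exists i, f = fun e => tnth e i.
#[export] Instance ctx_rV n : Ctx 'rV[int]_n :=
  fun f => exists i, f = fun e => e ord0 i.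
#[export] Instance ctx_prod X Y (cX : Ctx X) (cY : Ctx Y) : Ctx (X * Y) :=
  fun f => (exists2 v, cX v & f = fun z => v z.1) \/
           (exists2 v, cY v & f = fun z => v z.2).
#[export] Instance ctx_stream X (cX : Ctx X) : Ctx (nat -> X) :=
  fun f => exists k, exists2 v, cX v & f = fun e => v (e k).

Definition varc X {cX : Ctx X} (f : X -> int) :=
  vars f \/ exists c, f = fun=> c.

Definition dpred L (S : structure L int) X {cX : Ctx X} (P : X -> Prop) :=
  exists n (phi : formula L n) (v : 'I_n -> X -> int),
    (forall i, varc (v i)) /\
    (forall x, P x = sat S phi [tuple v i x | i < n]).

Definition dfun L (S : structure L int) X {cX : Ctx X} (f : X -> int) :=
  dpred S (fun z : X * int => z.2 = f z.1).

Section Definability.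
Variables (L : language) (S : structure L int).

Section Connectives.
Variables (X : Type) (cX : Ctx X).

Lemma eq_dpred (P Q : X -> Prop) :
  (forall x, P x <-> Q x) -> dpred S P -> dpred S Q.
Proof. by move=> PQ; have -> : P = Q by apply/funext => x; apply/propext. Qed.

Lemma dpred_false : dpred S (fun=> False : Prop).
Proof.
by exists 0, (FFalse L 0), (fun=> fun=> 0%R); split=> // i; right; exists 0%R.
Qed.

Lemma dpred_imp (P Q : X -> Prop) :
  dpred S P -> dpred S Q -> dpred S (fun x => P x -> Q x).
Proof.
move=> [n1 [phi1 [v1 [hv1 h1]]]] [n2 [phi2 [v2 [hv2 h2]]]].
exists (n1 + n2), (FImp (frename phi1 (@lshift n1 n2)) (frename phi2 (@rshift n1 n2))).
exists (fun i x => match split i with inl j => v1 j x | inr j => v2 j x end).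
split=> [i|x].
  case: (split i) => j; [exact: hv1|exact: hv2].
rewrite h1 h2 /= !sat_frename.
congr (_ -> _); congr (sat S _); apply: eq_from_tnth => i; rewrite !tnth_mktuple.
  by rewrite -[lshift n2 i]/(unsplit (inl i)) unsplitK.
by rewrite -[rshift n1 i]/(unsplit (inr i)) unsplitK.
Qed.

Lemma dpred_not (P : X -> Prop) : dpred S P -> dpred S (fun x => ~ P x).
Proof. by move=> hP; exact: dpred_imp hP dpred_false. Qed.

Lemma dpred_true : dpred S (fun=> True : Prop).
Proof.
by apply: eq_dpred (dpred_not dpred_false) => x; split=> // _ [].
Qed.

Lemma dpred_or (P Q : X -> Prop) :
  dpred S P -> dpred S Q -> dpred S (fun x => P x \/ Q x).
Proof.
move=> hP hQ; apply: eq_dpred (dpred_imp (dpred_not hP) hQ) => x.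
by split=> [h|[]//]; have [?|/h ?] := EM (P x); [left|right].
Qed.

Lemma dpred_and (P Q : X -> Prop) :
  dpred S P -> dpred S Q -> dpred S (fun x => P x /\ Q x).
Proof.
move=> hP hQ; apply: eq_dpred (dpred_not (dpred_imp hP (dpred_not hQ))) => x.
by split=> [h|[? ?]]; [apply: contrapT => h'; apply: h => p q; exact: h'|exact].
Qed.

Lemma dpred_iff (P Q : X -> Prop) :
  dpred S P -> dpred S Q -> dpred S (fun x => P x <-> Q x).
Proof. by move=> hP hQ; apply: dpred_and; apply: dpred_imp. Qed.

End Connectives.

Arguments dpred_false {X cX}.
Arguments dpred_true {X cX}.

Section Quantifiers.
Variables (X : Type) (cX : Ctx X).

Lemma dpred_all (P : X -> int -> Prop) :
  dpred S (fun z : X * int => P z.1 z.2) -> dpred S (fun x => forall a, P x a).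
Proof.
move=> [n [phi [v [hv h]]]].
(* Variables that read the last coordinate become the bound variable 0 of [FAll]; the others factor
   through the first component. *)
pose isb i := v i = @snd X int.
have hv' i : exists u : X -> int, varc u /\ (~ isb i -> forall z, v i z = u z.1).
  case: (hv i) => [[[u hu ->]|[u -> hs]]|[c hc]].
  - by exists u; split=> //; left.
  - by exists (fun=> 0%R); split; [right; exists 0%R|case].
  - by exists (fun=> c); split; [right; exists c|rewrite hc].
have [u hu] := choice hv'.
exists n, (FAll (frename phi (fun i => if `[< isb i >] then ord0 else lift ord0 i))).
exists u; split=> [i|x]; first by case: (hu i).
rewrite /=; apply: eq_forall => a.
rewrite sat_frename; have -> := h (x, a).
congr (sat S phi _); apply: eq_from_tnth => i; rewrite !tnth_mktuple.
case: asboolP => hb; first by rewrite tnth0 hb.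
by rewrite tnthS tnth_mktuple; case: (hu i) => _ ->.
Qed.

Lemma dpred_ex (P : X -> int -> Prop) :
  dpred S (fun z : X * int => P z.1 z.2) -> dpred S (fun x => exists a, P x a).
Proof.
move=> hP; apply: eq_dpred (dpred_not (dpred_all (P := fun x a => ~ P x a) (dpred_not hP))) => x.
by rewrite -existsNP; split=> [[a /contrapT ha]|[a ha]]; exists a => //; move/(_ ha).
Qed.

Lemma dpred_all_mem (J : eqType) (s : seq J) (P : J -> X -> Prop) :
  (forall j, dpred S (P j)) -> dpred S (fun x => forall j, j \in s -> P j x).
Proof.
move=> hP; elim: s => [|j s IH].
  by apply: eq_dpred dpred_true => x; split.
apply: eq_dpred (dpred_and (hP j) IH) => x; split=> [[h h'] k|h].
  by rewrite inE => /predU1P[->//|]; exact: h'.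
by split=> [|k ks]; apply: h; rewrite inE ?eqxx// ks orbT.
Qed.

Lemma dpred_ex_mem (J : eqType) (s : seq J) (P : J -> X -> Prop) :
  (forall j, dpred S (P j)) -> dpred S (fun x => exists2 j, j \in s & P j x).
Proof.
move=> hP.
apply: eq_dpred (dpred_not (dpred_all_mem s (P := fun j x => ~ P j x) (fun j => dpred_not (hP j)))) => x.
split=> [h|[j js hj] h]; last exact: h js hj.
by apply: contrapT => h'; apply: h => j js hj; apply: h'; exists j.
Qed.

End Quantifiers.


Lemma varc_comp X (cX : Ctx X) Y (cY : Ctx Y) (g : X -> Y) :
  (forall v, vars v -> varc (fun x => v (g x))) ->
  forall v, varc v -> varc (fun x => v (g x)).
Proof. by move=> h v [/h//|[c ->]]; right; exists c. Qed.

Lemma dpred_pull X (cX : Ctx X) Y (cY : Ctx Y) (g : X -> Y) (P : Y -> Prop) :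
  (forall v, vars v -> varc (fun x => v (g x))) ->
  dpred S P -> dpred S (fun x => P (g x)).
Proof.
move=> hg [n [phi [v [hv h]]]]; exists n, phi, (fun i x => v i (g x)).
by split=> // i; exact: varc_comp.
Qed.

Lemma dfun_pull X (cX : Ctx X) Y (cY : Ctx Y) (g : X -> Y) (f : Y -> int) :
  (forall v, vars v -> varc (fun x => v (g x))) ->
  dfun S f -> dfun S (fun x => f (g x)).
Proof.
move=> hg hf.
apply: (dpred_pull (g := fun z : X * int => (g z.1, z.2)) (P := fun z => z.2 = f z.1)) => //.
move=> v [[w hw ->]|[w -> ->]] /=; last by left; right; exists id.
apply: (@varc_comp _ _ _ _ fst _ (fun x => w (g x))); last exact: hg.
by move=> u hu; left; left; exists u.
Qed.

Lemma dpred_eq_varc X (cX : Ctx X) (u v : X -> int) :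
  varc u -> varc v -> dpred S (fun x => u x = v x).
Proof.
move=> hu hv; exists 2, (FEq (Var L (@ord0 1)) (Var L (@ord_max 1))).
exists (fun i => if i == ord0 then u else v); split=> [i|x]; first by case: ifP.
by rewrite /= !tnth_mktuple.
Qed.

Lemma dfun_varc X (cX : Ctx X) (v : X -> int) : varc v -> dfun S v.
Proof.
move=> hv; apply: dpred_eq_varc; first by left; right; exists id.
by apply: (varc_comp (g := fst)) hv => u hu; left; left; exists u.
Qed.

Lemma dfun_cst X (cX : Ctx X) (c : int) : dfun S (fun _ : X => c).
Proof. by apply: dfun_varc; right; exists c. Qed.

Lemma dfun_var X (cX : Ctx X) (v : X -> int) : vars v -> dfun S v.
Proof. by move=> hv; apply: dfun_varc; left. Qed.

(** Substitution of functions for variables, one at a time. The function of index [k] is replaced by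
    a fresh last coordinate that is quantified and required to equal it; those of larger index are
    already coordinates or constants. *)
Lemma sat_dfun_varc n (phi : formula L n) k X (cX : Ctx X) (f : 'I_n -> X -> int) :
  (k <= n)%N -> (forall i, dfun S (f i)) ->
  (forall i : 'I_n, (k <= i)%N -> varc (f i)) ->
  dpred S (fun x => sat S phi [tuple f i x | i < n]).
Proof.
elim: k X cX f => [|k IH] X cX f kn hf hv.
  by exists n, phi, f; split=> // i; exact: hv.
pose ik := Ordinal kn.
pose f' i (z : X * int) := if i == ik then z.2 else f i z.1.
have hfst : forall v : X -> int, vars v -> varc (fun z : X * int => v z.1).
  by move=> v hv'; left; left; exists v.
have h := @dpred_ex X cX (fun x a => a = f ik x /\ sat S phi [tuple f' i (x, a) | i < n]).
apply: eq_dpred (h _) => [x|].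
  split=> [[a [-> h']]|h']; last exists (f ik x); last split=> //.
    rewrite (_ : [tuple _ | _ < n] = [tuple f' i (x, f ik x) | i < n])//.
    by apply: eq_from_tnth => i; rewrite !tnth_mktuple /f' /=; case: eqP => // ->.
  rewrite (_ : [tuple _ | _ < n] = [tuple f i x | i < n])//.
  by apply: eq_from_tnth => i; rewrite !tnth_mktuple /f' /=; case: eqP => // ->.
apply: dpred_and; first exact: (hf ik).
apply: eq_dpred (IH _ _ f' (ltnW kn) _ _) => [[x a]//|i|i ki]; rewrite /f'.
  case: eqP => _; last exact: dfun_pull.
  by apply: dfun_var; right; exists id.
case: eqP => [_|/eqP ni]; first by left; right; exists id.
apply: (varc_comp hfst (v := f i)); apply: hv.
by rewrite ltn_neqAle ki andbT eq_sym -val_eqE in ni *.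
Qed.

Lemma sat_dfun n (phi : formula L n) X (cX : Ctx X) (f : 'I_n -> X -> int) :
  (forall i, dfun S (f i)) ->
  dpred S (fun x => sat S phi [tuple f i x | i < n]).
Proof.
by move=> hf; apply: (@sat_dfun_varc n phi n) => // i; rewrite leqNgt ltn_ord.
Qed.

Lemma dpred_subst X (cX : Ctx X) Y (cY : Ctx Y) (g : X -> Y) (P : Y -> Prop) :
  (forall v, vars v -> dfun S (fun x => v (g x))) ->
  dpred S P -> dpred S (fun x => P (g x)).
Proof.
move=> hg [n [phi [v [hv h]]]].
apply: eq_dpred (sat_dfun phi (f := fun i x => v i (g x)) _) => [x|i]; first by rewrite h.
by case: (hv i) => [/hg//|[c ->]]; exact: dfun_cst.
Qed.

Lemma dfun_subst X (cX : Ctx X) Y (cY : Ctx Y) (g : X -> Y) (f : Y -> int) :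
  (forall v, vars v -> dfun S (fun x => v (g x))) ->
  dfun S f -> dfun S (fun x => f (g x)).
Proof.
move=> hg hf.
apply: (dpred_subst (g := fun z : X * int => (g z.1, z.2)) (P := fun z => z.2 = f z.1)) => //.
move=> v [[w hw ->]|[w -> ->]] /=; last by apply: dfun_var; right; exists id.
apply: (@dfun_pull _ _ _ _ fst (fun x => w (g x))); last exact: hg.
by move=> u hu; left; left; exists u.
Qed.

Lemma dfun_dom X (cX : Ctx X) Y (cY : Ctx Y) (f : X -> int) :
  dfun S f -> dfun S (fun z : X * Y => f z.1).
Proof. by apply: dfun_pull => v hv; left; left; exists v. Qed.

Lemma dfun_last X (cX : Ctx X) : dfun S (fun z : X * int => z.2).
Proof. by apply: dfun_var; right; exists id. Qed.

(** Meant for [f] that ignores its last coordinate, where 0 is a dummy value. Iterated by [dproj],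
    it peels off the coordinates in front of a projection. *)
Lemma dfun_fst X (cX : Ctx X) (f : X * int -> int) :
  (forall z, f z = f (z.1, 0%R)) -> dfun S (fun x => f (x, 0%R)) -> dfun S f.
Proof. by move=> /funext ->; exact: (dfun_dom _ (f := fun x => f (x, 0%R))). Qed.

Lemma dpred_eq X (cX : Ctx X) (f g : X -> int) :
  dfun S f -> dfun S g -> dpred S (fun x => f x = g x).
Proof.
move=> hf hg.
apply: (dpred_subst (g := fun x => (x, f x)) (P := fun z : X * int => z.2 = g z.1)) => //.
move=> v [[w hw ->]|[w -> ->]] //=; exact: dfun_var.
Qed.

Lemma definable_dpred n (A : set (n.-tuple int)) :
  definable S A <-> dpred S (fun e : n.-tuple int => A e).
Proof.
split=> [[m [phi [b ->]]]|[N [phi [v [hv h]]]]].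
  exists (n + m), phi.
  exists (fun i e => match split i with inl j => tnth e j | inr j => tnth b j end).
  split=> [i|e].
    by case: (split i) => j; [left; exists j|right; exists (tnth b j)].
  rewrite /instance /mkset; congr (sat S phi); apply: eq_from_tnth => i.
  rewrite tnth_mktuple; case: split_ordP => j ->.
    by rewrite tnth_lshift.
  by rewrite tnth_rshift.
have hv' i : exists jc : ('I_n + int), v i = match jc with inl j => fun e => tnth e j | inr c => fun=> c end.
  by case: (hv i) => [[j ->]|[c ->]]; [exists (inl j)|exists (inr c)].
have [jc hjc] := choice hv'.
exists N, (frename phi (fun i => match jc i with inl j => lshift N j | inr c => rshift n i end)).
exists [tuple match jc i with inl j => 0%R | inr c => c end | i < N].
apply/funext => e; rewrite h /instance /mkset sat_frename.
congr (sat S phi); apply: eq_from_tnth => i; rewrite !tnth_mktuple hjc.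
case E: (jc i) => [j|c]; first by rewrite tnth_lshift.
by rewrite tnth_rshift tnth_mktuple E.
Qed.

(* The variables of [phi] are the value [z] followed by the parameters read off
   from [y]. *)
Lemma dpred_instance Y (cY : Ctx Y) (P : int * Y -> Prop) : dpred S P ->
  exists m (phi : formula L (1 + m)) (b : Y -> m.-tuple int),
    forall z y, P (z, y) = instance S phi (b y) [tuple z].
Proof.
move=> [N [phi [v [hv h]]]].
have hv' i : exists b : bool, forall z y, v i (z, y) = if b then z else v i (0%R, y).
  case: (hv i) => [[[w -> ->]|[w hw ->]]|[c ->]]; first by exists true.
    by exists false.
  by exists false.
have [d hd] := choice hv'.
exists N, (frename phi (fun i => if d i then lshift N (@ord0 0) else rshift 1 i)).
exists (fun y => [tuple v i (0%R, y) | i < N]) => z y.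
rewrite h /instance /mkset sat_frename; congr (sat S phi).
apply: eq_from_tnth => i; rewrite !tnth_mktuple hd.
case: (d i); first by rewrite tnth_lshift.
by rewrite tnth_rshift tnth_mktuple.
Qed.

End Definability.

Ltac dproj :=
  repeat first [exact: dfun_last | apply: dfun_fst; [by [] | rewrite /=]].

Arguments dpred_false {L S X cX}.
Arguments dpred_true {L S X cX}.

(** Terms and formulas arise by substitution, implication and quantification, and definability in
    [S2] is closed under these, so only the symbols of [L1] have to be checked. *)
Lemma dpred_sat L1 (S1 : structure L1 int) L2 (S2 : structure L2 int) :
  (forall f : Defs.fsym L1, dfun S2 (fun e : (farity f).-tuple int => finterp S1 e)) ->
  (forall r : rsym L1, dpred S2 (fun e : (rarity r).-tuple int => rinterp S1 e)) ->
  forall n (phi : formula L1 n), dpred S2 (fun e : n.-tuple int => sat S1 phi e).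
Proof.
move=> hf hr.
have ht n (t : term L1 n) : dfun S2 (fun e : n.-tuple int => eval S1 e t).
  elim: t => [i|f ts IH] /=; first by apply: dfun_var; exists i.
  apply: (dfun_subst (g := fun e : n.-tuple int => [tuple eval S1 e (ts i) | i < farity f])) (hf f) => v [i ->].
  by under eq_fun do rewrite tnth_mktuple.
move=> n; elim=> {n} [n|n t u|n r ts|n phi IHphi psi IHpsi|n phi IH] /=.
- exact: dpred_false.
- exact: dpred_eq.
- apply: (dpred_subst (g := fun e : n.-tuple int => [tuple eval S1 e (ts i) | i < rarity r])) (hr r) => v [i ->].
  by under eq_fun do rewrite tnth_mktuple.
- exact: dpred_imp.
- apply: (dpred_all (P := fun (e : n.-tuple int) a => sat S1 phi [tuple of a :: e])).
  apply: (dpred_pull (g := fun z : n.-tuple int * int => [tuple of z.2 :: z.1])) IH => v [i ->].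
  left; case: (unliftP ord0 i) => [j ->|->].
    by left; exists (fun e => tnth e j); [exists j|apply/funext => z; rewrite tnthS].
  by right; exists id => //; apply/funext => z; rewrite tnth0.
Qed.

Lemma dpred_transfer L1 (S1 : structure L1 int) L2 (S2 : structure L2 int) :
  (forall f : Defs.fsym L1, dfun S2 (fun e : (farity f).-tuple int => finterp S1 e)) ->
  (forall r : rsym L1, dpred S2 (fun e : (rarity r).-tuple int => rinterp S1 e)) ->
  forall X (cX : Ctx X) (P : X -> Prop), dpred S1 P -> dpred S2 P.
Proof.
move=> hf hr X cX P [n [phi [v [hv h]]]].
apply: eq_dpred (dpred_pull (g := fun x => [tuple v i x | i < n]) _ (dpred_sat hf hr phi)) => [x|u [i ->]].
  by rewrite h.
by under eq_fun do rewrite tnth_mktuple.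
Qed.

Local Open Scope ring_scope.

(** * Structures that define addition or the order *)

Definition has_add L (S : structure L int) :=
  dpred S (fun z : int * int * int => z.2 = z.1.1 + z.1.2).

Definition has_lt L (S : structure L int) :=
  dpred S (fun z : int * int => z.1 < z.2).

Section Addition.
Variables (L : language) (S : structure L int) (addS : has_add S).

Lemma dfunD X (cX : Ctx X) (f g : X -> int) :
  dfun S f -> dfun S g -> dfun S (fun x => f x + g x).
Proof.
move=> hf hg.
apply: (dpred_subst (g := fun z : X * int => (f z.1, g z.1, z.2))) addS.
move=> v [[w [[u -> ->]|[u -> ->]] ->]|[w -> ->]] /=; try exact: dfun_dom.
by apply: dfun_var; right; exists id.
Qed.

Lemma dfunN X (cX : Ctx X) (f : X -> int) : dfun S f -> dfun S (fun x => - f x).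
Proof.
move=> hf.
apply: eq_dpred (dpred_eq (f := fun z : X * int => z.2 + f z.1) (g := fun=> 0) _ _) => [[x a] /=||].
- by split=> [/eqP|->]; [rewrite addr_eq0 => /eqP|rewrite addNr].
- by apply: dfunD; [apply: dfun_var; right; exists id|exact: dfun_dom].
- exact: dfun_cst.
Qed.

Lemma dfunB X (cX : Ctx X) (f g : X -> int) :
  dfun S f -> dfun S g -> dfun S (fun x => f x - g x).
Proof. by move=> hf hg; apply: dfunD => //; exact: dfunN. Qed.

Lemma dfunMl X (cX : Ctx X) (c : int) (f : X -> int) :
  dfun S f -> dfun S (fun x => c * f x).
Proof.
move=> hf; have hn (k : nat) : dfun S (fun x => k%:Z * f x).
  elim: k => [|k IH]; first by under eq_fun do rewrite mul0r; exact: dfun_cst.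
  by under eq_fun do rewrite intS mulrDl mul1r; exact: dfunD.
case: c => k; first exact: hn.
by under eq_fun do rewrite NegzE mulNr; apply: dfunN; exact: hn.
Qed.

Lemma dfunMr X (cX : Ctx X) (c : int) (f : X -> int) :
  dfun S f -> dfun S (fun x => f x * c).
Proof. by under [X in _ -> dfun _ X]eq_fun do rewrite mulrC; exact: dfunMl. Qed.

Lemma dpred_modz X (cX : Ctx X) (m : int) (f g : X -> int) :
  dfun S f -> dfun S g -> dpred S (fun x => (m %| f x - g x)%Z).
Proof.
move=> hf hg.
apply: eq_dpred (dpred_ex (P := fun x k => f x - g x = k * m) _) => [x|].
  by split=> [[k ->]|/dvdzP//]; exact: dvdz_mull.
apply: dpred_eq; first by apply: dfunB; exact: dfun_dom.
by apply: dfunMr; apply: dfun_var; right; exists id.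
Qed.

Section Order.
Hypothesis ltS : has_lt S.

Lemma dpred_lt X (cX : Ctx X) (f g : X -> int) :
  dfun S f -> dfun S g -> dpred S (fun x => f x < g x).
Proof.
move=> hf hg; apply: (dpred_subst (g := fun x => (f x, g x))) ltS.
by move=> v [[w -> ->]|[w -> ->]].
Qed.

Lemma dpred_le X (cX : Ctx X) (f g : X -> int) :
  dfun S f -> dfun S g -> dpred S (fun x => f x <= g x).
Proof.
move=> hf hg; apply: eq_dpred (dpred_not (dpred_lt hg hf)) => x.
by rewrite leNgt; split=> /negP.
Qed.

End Order.

(* A definable set of integers that distinguishes the two ends is a half-line
   up to finitely many points. *)
Lemma has_lt_ends (T : int -> Prop) (K : nat) :
  dpred S T -> (forall s : int, K%:Z <= s -> T s) -> (forall s : int, s <= - K%:Z -> ~ T s) ->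
  has_lt S.
Proof.
move=> hT T1 T0.
have hK : dpred S (fun t : int => K%:Z <= t).
  (* [s] lists the integers from -K to K - 1; removing them from [T] leaves exactly the integers
     that are at least K. *)
  pose s := [seq i%:Z - K%:Z | i <- iota 0 (K + K)].
  apply: eq_dpred (dpred_and hT (dpred_all_mem s (P := fun j t => t <> j) _)) => [t|j]; last first.
    by apply: dpred_not; apply: dpred_eq; [exact: dfun_var|exact: dfun_cst].
  split=> [[Tt ts]|Kt]; last first.
    by split=> [|_ /mapP[i + ->]]; [exact: T1|rewrite mem_iota; lia].
  rewrite leNgt; apply/negP => tK.
  have [tK'|Kt] := lerP t (- K%:Z); first exact: T0 tK' Tt.
  apply: (ts t) => //; apply/mapP; exists `|(t + K%:Z)%R|%N; last by lia.
  by rewrite mem_iota; lia.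
apply: eq_dpred (dpred_subst (g := fun z : int * int => z.2 - z.1 + (K%:Z - 1)) _ hK) => [[x y]|v ->] /=.
- by split; lia.
- apply: dfunD; last exact: dfun_cst.
  by apply: dfunB; apply: dfun_var; [right|left]; exists id.
Qed.

End Addition.

Lemma dfun_tnth L (S : structure L int) n (i : 'I_n) :
  dfun S (fun e : n.-tuple int => tnth e i).
Proof. by apply: dfun_var; exists i. Qed.

Lemma tuple2E (e : 2.-tuple int) :
  (e`_0 = tnth e ord0) * (e`_1 = tnth e ord_max).
Proof. by rewrite !(tnth_nth 0). Qed.

Lemma has_add_group L (S : structure L int) :
  (forall f : Defs.fsym group_language,
    dfun S (fun e : (farity f).-tuple int => @finterp group_language int Zgroup f e)) -> has_add S.
Proof.
move=> /(_ Add) h.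
apply: (dpred_pull (g := fun z : int * int * int => ([tuple z.1.1; z.1.2], z.2))) h.
move=> v [[w [i ->] ->]|[w -> ->]] /=; left; last by right; exists id.
case: i => -[|[|//]] lti; left.
  by exists fst; first by left; exists id.
by exists snd; first by right; exists id.
Qed.

Lemma dfun_group L (S : structure L int) : has_add S ->
  forall f : Defs.fsym group_language,
    dfun S (fun e : (farity f).-tuple int => @finterp group_language int Zgroup f e).
Proof.
move=> addS []; first exact: dfun_cst.
apply: (dfunD addS (f := fun e : 2.-tuple int => e`_0) (g := fun e => e`_1)).
  by under eq_fun do rewrite tuple2E; exact: dfun_tnth.
by under eq_fun do rewrite tuple2E; exact: dfun_tnth.
Qed.

Lemma dfun_finterp L (S : structure L int) (f : Defs.fsym L) :
  dfun S (fun e : (farity f).-tuple int => finterp S e).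
Proof.
exists (farity f).+1, (FEq (Var L ord0) (App (fun j => Var L (lift ord0 j)))).
exists (fun i z => if unlift ord0 i is Some j then tnth z.1 j else z.2).
split=> [i|[e y]] /=.
  left; case: unliftP => [j _|_]; last by right; exists id.
  by left; exists (fun e => tnth e j); first by exists j.
rewrite tnth_mktuple unlift_none /=; congr (_ = finterp S _).
by apply: eq_from_tnth => j; rewrite !tnth_mktuple liftK.
Qed.

Lemma dpred_rinterp L (S : structure L int) (r : rsym L) :
  dpred S (fun e : (rarity r).-tuple int => rinterp S e).
Proof.
exists (rarity r), (FRel (fun j => Var L j)), (fun i e => tnth e i).
split=> [i|e] /=; first by left; exists i.
by congr (rinterp S _); apply: eq_from_tnth => j; rewrite !tnth_mktuple.
Qed.

Lemma has_add_Zgroup : has_add Zgroup.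
Proof. exact/has_add_group/dfun_finterp. Qed.

Lemma has_add_rel n (A : set (n.-tuple int)) : has_add (add_rel Zgroup A).
Proof. exact/has_add_group/(dfun_finterp (add_rel Zgroup A)). Qed.

Lemma dpred_rel n (A : set (n.-tuple int)) : dpred (add_rel Zgroup A) A.
Proof. exact: (dpred_rinterp (add_rel Zgroup A) None). Qed.

Lemma dpred_from_rel L (S : structure L int) (addS : has_add S) n
    (A : set (n.-tuple int)) (dA : dpred S A) X (cX : Ctx X) (P : X -> Prop) :
  dpred (add_rel Zgroup A) P -> dpred S P.
Proof. by apply: dpred_transfer; [exact: dfun_group|case]. Qed.

Lemma dpred_Zlt L (S : structure L int) : has_lt S <-> dpred S Zlt.
Proof.
split=> h.
  apply: (dpred_subst (g := fun e : 2.-tuple int => (e`_0, e`_1))) h => v [[w -> ->]|[w -> ->]] /=.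
    by under eq_fun do rewrite tuple2E; exact: dfun_tnth.
  by under eq_fun do rewrite tuple2E; exact: dfun_tnth.
apply: (dpred_pull (g := fun z : int * int => [tuple z.1; z.2])) h.
by move=> v [[[|[|//]] lti] ->]; left; [left|right]; exists id.
Qed.

Lemma has_add_Presburger : has_add Presburger.
Proof. exact: has_add_rel. Qed.

Lemma has_lt_Presburger : has_lt Presburger.
Proof. exact/dpred_Zlt/dpred_rel. Qed.

Lemma dpred_from_Presburger L (S : structure L int) (addS : has_add S)
    (ltS : has_lt S) X (cX : Ctx X) (P : X -> Prop) :
  dpred Presburger P -> dpred S P.
Proof. by apply: dpred_from_rel => //; exact/dpred_Zlt. Qed.

Lemma has_add_expansion L (S : structure L int) :
  is_expansion S Zgroup -> has_add S.
Proof.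
move=> exp.
have /definable_dpred : definable S (fun e : 3.-tuple int => e`_2 = e`_0 + e`_1).
  apply: exp => //; apply/definable_dpred.
  have d (k : 'I_3) : dfun Zgroup (fun e : 3.-tuple int => e`_k).
    by under eq_fun do rewrite -tnth_nth; exact: dfun_tnth.
  apply: (dpred_eq (d (@Ordinal 3 2 isT))).
  exact: (dfunD has_add_Zgroup (d (@Ordinal 3 0 isT)) (d (@Ordinal 3 1 isT))).
apply: (dpred_pull (g := fun z : int * int * int => [tuple z.1.1; z.1.2; z.2])).
move=> v [[[|[|[|//]]] lti] ->]; left.
- by left; exists fst; first by left; exists id.
- by left; exists snd; first by right; exists id.
- by right; exists id.
Qed.

(** * Quantifier elimination *)

Inductive aff X {cX : Ctx X} : (X -> int) -> Prop :=
| aff_cst c : aff (fun=> c)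
| aff_var v : vars v -> aff v
| affD f g : aff f -> aff g -> aff (fun x => f x + g x)
| affN f : aff f -> aff (fun x => - f x).

Lemma aff_comp X (cX : Ctx X) Y (cY : Ctx Y) (g : X -> Y) (f : Y -> int) :
  (forall v, vars v -> aff (fun x => v (g x))) -> aff f -> aff (fun x => f (g x)).
Proof.
move=> hg; elim=> {f} [c|v /hg//|f1 f2 _ IH1 _ IH2|f _ IH].
- exact: (aff_cst c).
- exact: affD IH1 IH2.
- exact: affN IH.
Qed.

Lemma affMl X (cX : Ctx X) (c : int) (f : X -> int) :
  aff f -> aff (fun x => c * f x).
Proof.
move=> hf; have hn (k : nat) : aff (fun x => k%:Z * f x).
  elim: k => [|k IH]; first by under eq_fun do rewrite mul0r; exact: aff_cst.
  by under eq_fun do rewrite intS mulrDl mul1r; exact: affD.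
case: c => k; first exact: hn.
by under eq_fun do rewrite NegzE mulNr; apply: affN; exact: hn.
Qed.

Definition cong X {cX : Ctx X} (m : nat) (x y : X) :=
  forall v, vars v -> (m%:Z %| v x - v y)%Z.

Lemma aff_cong X (cX : Ctx X) m (x y : X) (f : X -> int) :
  cong m x y -> aff f -> (m%:Z %| f x - f y)%Z.
Proof.
move=> xy; elim=> {f} [c|v /xy//|f g _ hf _ hg|f _ hf].
- by rewrite subrr dvdz0.
- by rewrite opprD addrACA rpredD.
- by rewrite -opprD rpredN.
Qed.

(* The traces of formulas without quantifiers over the language with order and
   congruences: sets that are unions of classes for finitely many affine
   inequalities and one congruence. *)
Definition qfree X {cX : Ctx X} (P : X -> Prop) :=
  exists (m : nat) (I : finType) (l : I -> X -> int),
    [/\ (0 < m)%N, forall i, aff (l i) &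
     forall x y, cong m x y -> (forall i, (0 <= l i x) = (0 <= l i y)) ->
       P x -> P y].

Lemma congC X (cX : Ctx X) m (x y : X) : cong m x y -> cong m y x.
Proof. by move=> h v hv; rewrite -opprB rpredN h. Qed.

Lemma cong_dvd X (cX : Ctx X) m n (x y : X) : (m %| n)%N -> cong n x y -> cong m x y.
Proof. by move=> mn h v /h; apply: dvdz_trans. Qed.

Lemma qfree_pull X (cX : Ctx X) Y (cY : Ctx Y) (g : X -> Y) (P : Y -> Prop) :
  (forall v, vars v -> aff (fun x => v (g x))) ->
  qfree P -> qfree (fun x => P (g x)).
Proof.
move=> hg [m [I [l [m0 hl h]]]]; exists m, I, (fun i x => l i (g x)).
split=> // [i|x y xy]; first exact: aff_comp.
by apply: h => v /hg; exact: aff_cong.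
Qed.

Lemma qfree_ge0 X (cX : Ctx X) (f : X -> int) : aff f -> qfree (fun x => 0 <= f x).
Proof. by move=> hf; exists 1%N, unit, (fun=> f); split=> // x y _ /(_ tt) ->. Qed.

Lemma qfree_imp X (cX : Ctx X) (P Q : X -> Prop) :
  qfree P -> qfree Q -> qfree (fun x => P x -> Q x).
Proof.
move=> [m1 [I1 [l1 [m10 hl1 h1]]]] [m2 [I2 [l2 [m20 hl2 h2]]]].
exists (m1 * m2)%N, (I1 + I2)%type, (fun i => match i with inl i => l1 i | inr i => l2 i end).
split=> [|[]//|x y xy hxy PQ Py]; first by rewrite muln_gt0 m10.
apply: (h2 x) => [|i|]; first by apply: cong_dvd xy; exact: dvdn_mull.
  exact: (hxy (inr i)).
apply: PQ; apply: (h1 y) => [|i|//]; last by rewrite (hxy (inl i)).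
by apply/congC; apply: cong_dvd xy; exact: dvdn_mulr.
Qed.

Lemma qfree_false X (cX : Ctx X) : qfree (fun _ : X => False).
Proof. by exists 1%N, void, (fun=> fun=> 0); split=> // -[]. Qed.

Lemma qfree_not X (cX : Ctx X) (P : X -> Prop) : qfree P -> qfree (fun x => ~ P x).
Proof. by move=> hP; apply: qfree_imp => //; exact: qfree_false. Qed.

Lemma eq_qfree X (cX : Ctx X) (P Q : X -> Prop) :
  (forall x, P x <-> Q x) -> qfree P -> qfree Q.
Proof. by move=> PQ; have -> : P = Q by apply/funext => x; apply/propext. Qed.

Lemma qfree_and X (cX : Ctx X) (P Q : X -> Prop) :
  qfree P -> qfree Q -> qfree (fun x => P x /\ Q x).
Proof.
move=> hP hQ; apply: eq_qfree (qfree_not (qfree_imp hP (qfree_not hQ))) => x.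
by split=> [h|[? ?]]; [apply: contrapT => h'; apply: h => p q; exact: h'|exact].
Qed.

Lemma qfree_eq X (cX : Ctx X) (f g : X -> int) :
  aff f -> aff g -> qfree (fun x => f x = g x).
Proof.
move=> hf hg.
apply: eq_qfree (qfree_and (qfree_ge0 (affD hf (affN hg))) (qfree_ge0 (affD hg (affN hf)))) => x.
by rewrite !subr_ge0; split=> [[fg gf]|->//]; apply/eqP; rewrite eq_le fg gf.
Qed.

Lemma aff_prod X (cX : Ctx X) (f : X * int -> int) : aff f ->
  exists (g : X -> int) (c : int), aff g /\ forall x t, f (x, t) = g x + c * t.
Proof.
elim=> {f} [c|v [[w hw ->]|[w -> ->]]|f1 f2 _ [g1 [c1 [h1 e1]]] _ [g2 [c2 [h2 e2]]]|f _ [g [c [h e]]]].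
- by exists (fun=> c), 0; split=> [|x t]; [exact: aff_cst|rewrite mul0r addr0].
- by exists w, 0; split=> [|x t]; [exact: aff_var|rewrite mul0r addr0].
- by exists (fun=> 0), 1; split=> [|x t]; [exact: aff_cst|rewrite mul1r add0r].
- exists (fun x => g1 x + g2 x), (c1 + c2); split=> [|x t]; first exact: affD.
  by rewrite e1 e2; ring.
- exists (fun x => - g x), (- c); split=> [|x t]; first exact: affN.
  by rewrite e; ring.
Qed.

(** Elimination in the style of Cooper. After scaling, the inequalities compare C t with thresholds
    depending on [x]. A witness [t] can be moved to a fixed residue above the largest threshold
    below C t, or far down if there is none. So the existence of a witness depends only on finitely
    many comparisons between thresholds and on [x] modulo D = C m. *)
Lemma qfree_ex X (cX : Ctx X) (P : X -> int -> Prop) :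
  qfree (fun z : X * int => P z.1 z.2) -> qfree (fun x => exists t, P x t).
Proof.
move=> [m [I [l [m0 hl hP]]]].
have /choice[f /choice[c hc]] i := aff_prod (hl i).
pose C := (\prod_(i | c i != 0) `|c i|)%N.
have C0 : (0 < C)%N by rewrite prodn_cond_gt0// => i; rewrite absz_gt0.
(* For a positive coefficient inequality i says that [tau i x] is at most C t, for a negative one it
   says the opposite; the added 1 in the latter case turns a strict bound into a weak one. *)
have /choice[tau htau] i : exists t : X -> int, aff t /\
    forall x y s s', (0 <= f i x) = (0 <= f i y) -> (t x <= C%:Z * s) = (t y <= C%:Z * s') ->
      (0 <= l i (x, s)) = (0 <= l i (y, s')).
  have [ci|ci0|ci0] := ltrgtP 0 (c i); last first.
  - exists (fun=> 0); split; first exact: aff_cst.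
    by move=> x y s s' hf _; have [_ e] := hc i; rewrite !e -ci0 !mul0r !addr0.
  - pose d := (\prod_(j | (c j != 0) && (j != i)) `|c j|)%N.
    have Cd : C%:Z = d%:Z * - c i.
      by rewrite /C (bigD1 i) ?lt_eqF//= -/d; lia.
    have d0 : 0 < d%:Z by nia.
    exists (fun x => d%:Z * f i x + 1); split; first exact/affD/aff_cst/affMl/(hc i).1.
    by move=> x y s s' _; have [_ e] := hc i; rewrite !e; nia.
  - pose d := (\prod_(j | (c j != 0) && (j != i)) `|c j|)%N.
    have Cd : C%:Z = d%:Z * c i.
      by rewrite /C (bigD1 i) ?gt_eqF//= -/d; lia.
    have d0 : 0 < d%:Z by nia.
    exists (fun x => - (d%:Z * f i x)); split; first exact/affN/affMl/(hc i).1.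
    by move=> x y s s' _; have [_ e] := hc i; rewrite !e; nia.
pose D := (C * m)%N.
have D0 : (0 < D)%N by rewrite muln_gt0 C0.
exists D, (I + I * I * 'I_D)%type,
  (fun k : I + I * I * 'I_D => match k with
            | inl i => f i
            | inr (i, j, r) => fun x => tau i x + (r%:Z + - tau j x) end).
split=> // [[i|[[i j] r]]|x y xy hxy [t Pxt]]; first exact: (hc i).1.
  by apply: affD (htau i).1 (affD (aff_cst _) (affN (htau j).1)).
have hf i : (0 <= f i x) = (0 <= f i y) := hxy (inl i).
suff [t' [tt' ht']] : exists t' : int, (m%:Z %| t - t')%Z /\
    forall i, (tau i x <= C%:Z * t) = (tau i y <= C%:Z * t').
  exists t'; move: Pxt; apply: (hP (x, t) (y, t')) => [|i]; last exact: (htau i).2.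
  by move=> v [[w hw ->]|[w -> ->]] //=; apply: cong_dvd xy _ hw; exact: dvdn_mull.
(* Without a threshold below C t, the new witness is a multiple of m away from [t] and below all
   thresholds of [y]. *)
have [i0 hi0|hB] := pickP (fun i => tau i x <= C%:Z * t); last first.
  exists (t - m%:Z * (1 + `|C%:Z * t| + \sum_i `|tau i y|)); split.
    by rewrite opprB addrC subrK dvdz_mulr.
  move=> i; rewrite hB; apply/esym/negbTE; rewrite -ltNge.
  have : `|tau i y| <= \sum_i `|tau i y|.
    by rewrite (bigD1 i)//= lerDl sumr_ge0.
  nia.
(* With i the largest threshold below C t and r the residue modulo D of its distance to C t, the
   witness for [y] is the t' with C t' = [tau i y] + r. It is an integer congruent to [t] modulo m
   because the thresholds of [x] and [y] are congruent modulo D = C m. *)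
have [i hi imax] := @Order.TotalTheory.arg_maxP _ _ _ i0 (fun i => tau i x <= C%:Z * t) (tau^~ x) hi0.
have r0 : 0 <= ((C%:Z * t - tau i x) %% D)%Z by rewrite modz_ge0 // -lt0n.
have rD : (`|((C%:Z * t - tau i x) %% D)%Z|%N < D)%N.
  by rewrite -ltz_nat gez0_abs// ltz_pmod.
pose r := Ordinal rD.
have hr : C%:Z * t = tau i x + r%:Z + ((C%:Z * t - tau i x) %/ D)%Z * D%:Z.
  rewrite /= gez0_abs //.
  by rewrite -addrA [(_ %% _)%Z + _]addrC -divz_eq addrC subrK.
have /dvdzP[e he] : (D%:Z %| tau i x - tau i y)%Z by exact: aff_cong xy (htau i).1.
set k := (_ %/ _)%Z in hr.
have DE : D%:Z = C%:Z * m%:Z by rewrite /D PoszM.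
exists (t - (k + e) * m%:Z); split.
  by rewrite opprB addrC subrK dvdz_mull.
have -> : C%:Z * (t - (k + e) * m%:Z) = tau i y + r%:Z by nia.
have k0 : 0 <= k by rewrite divz_ge0 ?subr_ge0.
move=> j.
have := hxy (inr (i, j, r)); rewrite !addrA !subr_ge0 => <-.
have hle : tau i x + r%:Z <= C%:Z * t by rewrite hr lerDl mulr_ge0.
apply/idP/idP => [/imax h|h]; last exact: le_trans h hle.
by apply: le_trans h _; rewrite lerDl.
Qed.

Lemma qfree_all X (cX : Ctx X) (P : X -> int -> Prop) :
  qfree (fun z : X * int => P z.1 z.2) -> qfree (fun x => forall t, P x t).
Proof.
move=> hP; apply: eq_qfree (qfree_not (qfree_ex (P := fun x t => ~ P x t) (qfree_not hP))) => x.
by split=> [h t|h [t]]; [apply: contrapT => ?; apply: h; exists t|].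
Qed.

Lemma aff_tnth n (i : 'I_n) : aff (fun e : n.-tuple int => tnth e i).
Proof. by apply: aff_var; exists i. Qed.

Lemma aff_eval n (t : term (add_rsym group_language 2) n) :
  aff (fun e : n.-tuple int => eval Presburger e t).
Proof.
elim: t => [i|[] ts IH]; first exact: aff_tnth.
  exact: aff_cst.
have -> : (fun e => eval Presburger e (App ts)) =
    (fun e => eval Presburger e (ts ord0) + eval Presburger e (ts ord_max)).
  apply/funext => e; pose t := [tuple eval Presburger e (ts i) | i < 2].
  by rewrite -[LHS]/(t`_0 + t`_1) !tuple2E !tnth_mktuple.
exact: affD.
Qed.

Lemma qfree_Presburger n (phi : formula (add_rsym group_language 2) n) :
  qfree (fun e : n.-tuple int => sat Presburger phi e).
Proof.
elim: phi => {n} [n|n t u|n [[]|] ts|n phi IHphi psi IHpsi|n phi IH].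
- exact: qfree_false.
- by apply: qfree_eq; exact: aff_eval.
- apply: eq_qfree (qfree_not (qfree_ge0 (affD (aff_eval (ts ord0)) (affN (aff_eval (ts ord_max)))))) => e.
  pose t := [tuple eval Presburger e (ts i) | i < 2].
  rewrite -[sat _ _ _]/(is_true (t`_0 < t`_1)) !tuple2E !tnth_mktuple subr_ge0 ltNge.
  by split=> /negP.
- exact: qfree_imp.
- apply: (qfree_all (P := fun (e : n.-tuple int) a => sat Presburger phi [tuple of a :: e])).
  apply: (qfree_pull (g := fun z : n.-tuple int * int => [tuple of z.2 :: z.1])) IH => v [i ->].
  apply: aff_var; case: (unliftP ord0 i) => [j ->|->].
    by left; exists (fun e => tnth e j); [exists j|apply/funext => z; rewrite tnthS].
  by right; exists id => //; apply/funext => z; rewrite tnth0.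
Qed.

Lemma dpred_qfree X (cX : Ctx X) (P : X -> Prop) : dpred Presburger P -> qfree P.
Proof.
move=> [n [phi [v [hv h]]]].
apply: eq_qfree (qfree_pull (g := fun x => [tuple v i x | i < n]) _ (qfree_Presburger phi)) => [x|u [i ->]].
  by rewrite h.
under eq_fun do rewrite tnth_mktuple.
by case: (hv i) => [/aff_var//|[c ->]]; exact: aff_cst.
Qed.

(** * Sets definable from addition and a Presburger set *)

Lemma dfun_aff L (S : structure L int) (addS : has_add S) X (cX : Ctx X)
  (f : X -> int) : aff f -> dfun S f.
Proof.
elim=> {f} [c|v hv|f g _ hf _ hg|f _ hf].
- exact: dfun_cst.
- exact: dfun_var.
- exact: dfunD.
- exact: dfunN.
Qed.

Lemma aff_rV n (f : 'rV[int]_n -> int) : aff f ->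
  exists (g : 'rV[int]_n -> int) (d : int),
    [/\ aff g, forall x, f x = g x + d, forall x y, g (x + y) = g x + g y &
        forall s x, g (s *: x) = s * g x].
Proof.
elim=> {f} [c|v hv|f1 f2 _ [g1 [d1 [a1 e1 D1 Z1]]] _ [g2 [d2 [a2 e2 D2 Z2]]]|f _ [g [d [a e D Z]]]].
- exists (fun=> 0), c; split=> [|x|x y|s x]; rewrite ?add0r ?mulr0//.
  exact: aff_cst.
- exists v, 0; case: (hv) => i ev; split=> [|x|x y|s x]; rewrite ?addr0 ?ev ?mxE//.
  by rewrite -ev; exact: aff_var.
- exists (fun x => g1 x + g2 x), (d1 + d2); split=> [|x|x y|s x].
  + exact: affD.
  + by rewrite e1 e2; ring.
  + by rewrite D1 D2; ring.
  + by rewrite Z1 Z2; ring.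
- exists (fun x => - g x), (- d); split=> [|x|x y|s x].
  + exact: affN.
  + by rewrite e; ring.
  + by rewrite D; ring.
  + by rewrite Z; ring.
Qed.

Lemma ge0_line (a b s : int) : `|a| < s ->
  (0 <= a + s * b) = if b == 0 then 0 <= a else 0 < b.
Proof.
move=> hs; have [->|b0] := eqVneq b 0; first by rewrite mulr0 addr0.
have [bp|bn] := ltrP 0 b; first by nia.
by have : b < 0; [rewrite lt_neqAle b0|nia].
Qed.

Lemma gt0_line (a b s : int) : `|a| < s ->
  (0 < a + s * b) = (if b == 0 then 0 < a else 0 < b) /\ (a != 0 -> a + s * b != 0).
Proof.
move=> hs; have [->|b0] := eqVneq b 0; first by rewrite mulr0 addr0.
have [bp|bn] := ltrP 0 b; first by have : s <= s * b; [nia|lia].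
have {}bn : b < 0 by rewrite lt_neqAle b0.
by have : s * b <= - s; [nia|lia].
Qed.

Lemma line_far (a b s t : int) (K k : nat) : b != 0 -> (`|a| <= k)%N ->
  (K.+1 + `|t| * k)%N%:Z <= s ->
  (K < `|(t * a + s * b)%R|)%N /\ (0 < t * a + s * b) = (0 < b).
Proof.
move=> b0 ak hs; have : (`|(t * a)%R| <= `|t| * k)%N by rewrite abszM leq_mul.
move: (t * a) (`|t| * k)%N hs => c e hs ce.
have [bp|bn] := ltrP 0 b.
  by have : s <= s * b; [nia|lia].
have {}bn : b < 0 by rewrite lt_neqAle b0.
by have : s * b <= - s; [nia|lia].
Qed.

Section Dichotomy.
Variables (L : language) (S : structure L int) (addS : has_add S).
Hypothesis nltS : ~ has_lt S.
Variables (n : nat) (A : 'rV[int]_n -> Prop) (dA : dpred S A).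
Variables (m : nat) (I : finType) (g : I -> 'rV[int]_n -> int) (d : I -> int).
Hypothesis m0 : (0 < m)%N.
Hypothesis affg : forall i, aff (g i).
Hypothesis gD : forall i x y, g i (x + y) = g i x + g i y.
Hypothesis gZ : forall i s x, g i (s *: x) = s * g i x.
Hypothesis hA : forall x y, cong m x y ->
  (forall i, (0 <= g i x + d i) = (0 <= g i y + d i)) -> A x -> A y.

Let gN i x : g i (- x) = - g i x.
Proof. by rewrite -scaleN1r gZ mulN1r. Qed.

Let sum_ge (F : I -> nat) i : (F i <= \sum_j F j)%N.
Proof. by rewrite (bigD1 i)//= leq_addr. Qed.

Definition multiple (w : 'rV[int]_n) := forall k, (m%:Z %| w ord0 k)%Z.

Lemma multiple_cong x w w' : multiple w -> multiple w' -> cong m (x + w) (x + w').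
Proof.
by move=> hw hw' v [k ->]; rewrite !mxE opprD addrACA subrr add0r rpredB.
Qed.

Lemma multipleD w w' : multiple w -> multiple w' -> multiple (w + w').
Proof. by move=> hw hw' k; rewrite mxE rpredD. Qed.

Lemma multipleZ s w : multiple w -> multiple (s *: w).
Proof. by move=> hw k; rewrite mxE dvdz_mull. Qed.

(** Steps by a multiple of [m] preserve the congruence, and along a ray each affine inequality
    eventually has a constant truth value. *)
Lemma ray_stable z u : multiple u ->
  exists s0 : nat, forall s : int, s0%:Z <= s -> A (z + s *: u) <-> A (z + s0%:Z *: u).
Proof.
move=> hu; exists (\sum_i `|(g i z + d i)%R|%N).+1 => s hs.
have h i : (0 <= g i (z + s *: u) + d i) =
    (0 <= g i (z + (\sum_i `|(g i z + d i)%R|%N).+1%:Z *: u) + d i).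
  have := sum_ge (fun i => `|(g i z + d i)%R|%N) i.
  move: (\sum_i _)%N hs => k hs hk.
  by rewrite !gD !gZ ![_ + _ * _ + _]addrAC !ge0_line //; lia.
by split; apply: hA => // *; apply: multiple_cong; exact: multipleZ.
Qed.

Section Flat.
Variables (E : {set I}) (p : 'rV[int]_n).

(** The lattice of translations of a flat: [p] plus this lattice is the part of the coset of [p] on
    which the forms in [E] keep their values at [p]. Enlarging [E] cuts the flat down. *)
Definition direction (E : {set I}) w := multiple w /\ forall i, i \in E -> g i w = 0.
Local Notation W := (direction E).

Lemma directionD w w' : W w -> W w' -> W (w + w').
Proof.
move=> [h h0] [h' h'0]; split=> [|i iE]; first exact: multipleD.
by rewrite gD h0// h'0.
Qed.

Lemma directionZ s w : W w -> W (s *: w).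
Proof.
move=> [h h0]; split=> [|i iE]; first exact: multipleZ.
by rewrite gZ h0// mulr0.
Qed.

Lemma directionB w w' : W w -> W w' -> W (w - w').
Proof. by move=> hw hw'; rewrite -scaleN1r; apply/directionD/directionZ. Qed.

Definition nonconst i := exists2 w, W w & g i w <> 0.

(** If [g i w] exceeds this bound in size, then its sign decides inequality i at [p + w]. *)
Let K : nat := \sum_i `|(g i p + d i)%R|%N.

(** Deep vectors lead from [p] beyond every affine hyperplane that cuts the flat. Generic ones avoid
    the parallel hyperplanes through [p], and [same_side] classifies them into the chambers of that
    central arrangement. *)
Definition deep w := W w /\ forall i, nonconst i -> (K < `|g i w|)%N.
Definition generic w := W w /\ forall i, nonconst i -> g i w <> 0.
Definition same_side w w' := forall i, nonconst i -> (0 < g i w) = (0 < g i w').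

Lemma deep_same_side w w' : deep w -> deep w' -> same_side w w' ->
  A (p + w) -> A (p + w').
Proof.
move=> [[mw Ww] hw] [[mw' Ww'] hw'] hs; apply: hA; first exact: multiple_cong.
move=> i; rewrite !gD; have [nci|ci] := EM (nonconst i).
  have := hs i nci; have := hw i nci; have := hw' i nci.
  by have := sum_ge (fun i => `|(g i p + d i)%R|%N) i; rewrite -/K; lia.
have g0 v : W v -> g i v = 0 by move=> Wv; apply: contrapT => ?; apply: ci; exists v.
by rewrite (g0 w (conj mw Ww)) (g0 w' (conj mw' Ww')).
Qed.

(* The constant value of [A] far away from [p] in the chamber of [w]. *)
Definition chamber w := A (p + K.+1%:Z *: w).

Lemma deepZ w : generic w -> deep (K.+1%:Z *: w).
Proof.
move=> [Ww hw]; split=> [|i nci]; first exact: directionZ.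
by rewrite gZ abszM leq_pmulr// absz_gt0; exact/eqP/hw.
Qed.

Lemma same_sideZ w : same_side w (K.+1%:Z *: w).
Proof. by move=> i _; rewrite gZ pmulr_rgt0. Qed.

Lemma same_sideC w w' : same_side w w' -> same_side w' w.
Proof. by move=> h i /h. Qed.

Lemma same_side_trans w w' w'' : same_side w w' -> same_side w' w'' -> same_side w w''.
Proof. by move=> h h' i nci; rewrite h// h'. Qed.

Lemma chamberE w w' : generic w -> deep w' -> same_side w w' ->
  A (p + w') <-> chamber w.
Proof.
move=> gw dw' ss; split; apply: deep_same_side => //; try exact: deepZ.
  by apply: same_side_trans (same_sideZ w); exact: same_sideC.
by apply: same_side_trans ss; apply/same_sideC/same_sideZ.
Qed.

Lemma chamber_same_side w w' : generic w -> generic w' -> same_side w w' ->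
  chamber w <-> chamber w'.
Proof.
move=> gw gw' ss; apply: iff_sym; apply: chamberE => //; first exact: deepZ.
by apply: same_side_trans ss (same_sideZ w').
Qed.

Lemma dpred_direction (q : 'rV[int]_n) (E' : {set I}) :
  dpred Zgroup (fun x => direction E' (x - q)).
Proof.
apply: eq_dpred (dpred_and (dpred_all_mem (enum 'I_n)
    (P := fun k (x : 'rV[int]_n) => (m%:Z %| x ord0 k - q ord0 k)%Z) _)
  (dpred_all_mem (enum E') (P := fun i x => g i x = g i q) _)) => [x|k|i].
- split=> [[h1 h2]|[h1 h2]]; split=> k.
  + by rewrite !mxE; apply: h1; rewrite mem_enum.
  + by move=> kE; rewrite gD gN h2 ?mem_enum// subrr.
  + by move=> _; have := h1 k; rewrite !mxE.
  + by rewrite mem_enum => /h2; rewrite gD gN => /eqP; rewrite subr_eq0 => /eqP.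
- apply: (dpred_modz has_add_Zgroup); last exact: dfun_cst.
  by apply: dfun_var; exists k.
- by apply: dpred_eq; [apply: dfun_aff has_add_Zgroup _ _ _ _|exact: dfun_cst].
Qed.

(** The strips around the hyperplanes consist of finitely many slices on which one more form is
    constant. A nonempty slice is a flat for [i |: E], based at any of its points [q], so the
    assumption on smaller flats applies to it. *)
Lemma dpred_strips (B : 'rV[int]_n -> Prop) :
  (forall i q, i \notin E -> dpred Zgroup (fun x => B x /\ direction (i |: E) (x - q))) ->
  (forall x, W (x - p) -> B x ->
     exists2 i, nonconst i & (`|g i (x - p)| <= K)%N) ->
  dpred Zgroup (fun x => B x /\ W (x - p)).
Proof.
move=> hB hs.
pose s := [seq i%:Z - K%:Z | i <- iota 0 (K + K).+1].
apply: eq_dpred (dpred_ex_mem (enum I) (P := fun i x => exists2 j, j \in s &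
   nonconst i /\ B x /\ W (x - p) /\ g i (x - p) = j) _) => [x|i].
  split=> [[i _ [j _ [_ [? [? _]]]]]//|[Bx Wx]].
  have [i nci hi] := hs x Wx Bx; exists i; rewrite ?mem_enum//.
  exists (g i (x - p)) => //.
  move: (g i (x - p)) hi => G hi; apply/mapP; exists `|(G + K%:Z)%R|%N.
    by rewrite mem_iota; lia.
  by lia.
apply: dpred_ex_mem => j.
have [nci|ci] := EM (nonconst i); last by apply: eq_dpred dpred_false => x; split=> // -[].
have iE : i \notin E.
  by apply/negP => iE; case: nci => w [_ /(_ _ iE)].
have [[q [Wq gq]]|nq] := EM (exists q, W (q - p) /\ g i (q - p) = j); last first.
  apply: eq_dpred dpred_false => x; split=> // -[_ [_ [Wx gx]]].
  by apply: nq; exists x.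
apply: eq_dpred (hB i q iE) => x; split=> [[Bx [mx hx]]|[_ [Bx [Wx gx]]]].
  have Wxq : W (x - q) by split=> // k kE; apply: hx; rewrite inE kE orbT.
  have xE : x - p = (x - q) + (q - p) by rewrite addrA subrK.
  split=> //; split=> //; split; first by rewrite xE; exact: directionD.
  by rewrite xE gD gq hx ?inE ?eqxx// add0r.
split=> //; have xE : x - q = (x - p) - (q - p) by rewrite opprB addrA subrK.
split=> [|k]; first by rewrite xE; case: (directionB Wx Wq).
rewrite !inE => /predU1P[->|kE]; first by rewrite xE gD gN gx gq subrr.
by rewrite xE; case: (directionB Wx Wq) => _ ->.
Qed.

(** For fixed [t] and large [s] the point is deep in the chamber of [w1]. Forms that do not vanish
    on [u] are dominated by the term in [s]. On the others [w] and [w'] have opposite nonzero signs,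
    so [w - w'] has the sign of [w], and the factor [t] makes it exceed K. *)
Lemma crossing w w' u : W w -> W w' -> W u ->
  (forall i, nonconst i -> g i u = 0 -> (0 < g i w) != (0 < g i w') /\ g i w != 0 /\ g i w' != 0) ->
  forall w1, generic w1 ->
  (forall i, nonconst i -> (0 < g i w1) = if g i u == 0 then 0 < g i w else 0 < g i u) ->
  forall t : int, K.+1%:Z <= t ->
  exists s0 : nat, forall s : int, s0%:Z <= s ->
     A (p + (t *: (w - w') + s *: u)) <-> chamber w1.
Proof.
move=> Ww Ww' Wu hu w1 gw1 hw1 t ht.
exists (K.+1 + `|t| * \sum_i `|g i (w - w')|)%N => s hs.
have Wx : W (t *: (w - w') + s *: u).
  by apply: directionD; apply: directionZ => //; exact: directionB.
apply: chamberE => //; first split=> // i nci.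
  rewrite gD !gZ.
  have := sum_ge (fun i => `|g i (w - w')|%N) i; move: (\sum_i _)%N hs => k hs hk.
  have [u0|u0] := eqVneq (g i u) 0; last by case: (line_far u0 hk hs).
  have := hu i nci u0; rewrite u0 gD gN mulr0 addr0 abszM.
  by move=> h; have : (0 < `|(g i w - g i w')%R|)%N; [lia|nia].
move=> i nci; rewrite hw1// gD !gZ.
have := sum_ge (fun i => `|g i (w - w')|%N) i; move: (\sum_i _)%N hs => k hs hk.
have [u0|u0] := eqVneq (g i u) 0; last by case: (line_far u0 hk hs).
rewrite u0 gD gN mulr0 addr0 pmulr_rgt0; last lia.
by have := hu i nci u0; lia.
Qed.

Lemma dpred_plane w u : dpred S (fun z : int * int => A (p + (z.1 *: w + z.2 *: u))).
Proof.
apply: (dpred_subst (g := fun z : int * int => p + (z.1 *: w + z.2 *: u))) dA => v [k ->].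
under eq_fun do rewrite !mxE.
apply: (dfunD addS); first exact: dfun_cst.
by apply: (dfunD addS); apply: (dfunMr addS); apply: dfun_var; [left|right]; exists id.
Qed.

(** On a line [A] is eventually constant at each end by [ray_stable]. If the two ends differed, the
    trace of [A] or of its complement would define the order by [has_lt_ends]. *)
Lemma ends_agree w u : multiple w -> multiple u -> forall t : int, exists s0 : nat,
  (forall s : int, s0%:Z <= `|s| -> A (p + (t *: w + s *: u))) \/
  (forall s : int, s0%:Z <= `|s| -> ~ A (p + (t *: w + s *: u))).
Proof.
move=> mw mu t; pose R s := A (p + t *: w + s *: u).
have dR : dpred S R.
  apply: eq_dpred (dpred_subst (g := fun s : int => (t, s)) _ (dpred_plane w u)) => [s|].
    by rewrite /R addrA.
  by move=> v [[v' -> ->]|[v' -> ->]] /=; [exact: dfun_cst|exact: dfun_var].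
have [s1 h1] := ray_stable (p + t *: w) mu.
have [s2 h2] := ray_stable (p + t *: w) (multipleZ (-1) mu).
exists (s1 + s2)%N.
have R1 s : s1%:Z <= s -> R s <-> R s1 by exact: h1.
have R2 s : s <= - s2%:Z -> R s <-> R (- s2%:Z).
  move=> hs; have := h2 (- s); rewrite !scalerA !mulrN1 opprK; apply; lia.
have Rend s : (s1 + s2)%N%:Z <= `|s| -> (R s <-> R s1) \/ (R s <-> R (- s2%:Z)).
  move=> hs; have [s0|s0] := lerP 0 s; [left; apply: R1|right; apply: R2]; lia.
have [p1|n1] := EM (R s1); have [p2|n2] := EM (R (- s2%:Z)).
- by left=> s /Rend; rewrite addrA -/(R s); tauto.
- case: nltS; apply: (has_lt_ends addS (T := R) (K := (s1 + s2)%N)) => // s hs.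
    have /R1 : s1%:Z <= s by lia.
    tauto.
  have /R2 : s <= - s2%:Z by lia.
    tauto.
- case: nltS; apply: (has_lt_ends addS (T := fun s => ~ R s) (K := (s1 + s2)%N)) => [|s hs|s hs].
  + exact: dpred_not.
  + have /R1 : s1%:Z <= s by lia.
    tauto.
  + have /R2 : s <= - s2%:Z by lia.
    tauto.
- by right=> s /Rend; rewrite addrA -/(R s); tauto.
Qed.

Definition separated w w' i := `[< nonconst i >] && ((0 < g i w) != (0 < g i w')).

(** The vectors [w1] and [w1'] lie in the chambers reached from [w] and [w'] by going far along [u].
    By [crossing], the line in direction [u] at height [t] ends in the first chamber for large [t]
    and in the second for very negative [t]; if [A] told them apart, the heights whose line is
    cofinite in [A] would define the order. *)
Lemma chamber_const_step w w' w1 w1' u : W w -> W w' -> W u ->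
  (forall i, nonconst i -> g i u = 0 -> (0 < g i w) != (0 < g i w') /\ g i w != 0 /\ g i w' != 0) ->
  generic w1 -> generic w1' ->
  (forall i, nonconst i -> (0 < g i w1) = if g i u == 0 then 0 < g i w else 0 < g i u) ->
  (forall i, nonconst i -> (0 < g i w1') = if g i u == 0 then 0 < g i w' else 0 < g i u) ->
  chamber w1 -> chamber w1'.
Proof.
move=> Ww Ww' Wu hu gw1 gw1' hw1 hw1' cw1; apply: contrapT => cw1'.
pose R (t s : int) := A (p + (t *: (w - w') + s *: u)).
(* As [R t] is finite or cofinite, [T t] says that it is cofinite. *)
pose T t := exists c, forall s, R t s \/ R t (s - c).
have TE t s0 (b : Prop) : (forall s : int, s0%:Z <= s -> R t s <-> b) -> T t <-> b.
  move=> hb; have [s1 h] := ends_agree (directionB Ww Ww').1 Wu.1 t.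
  have [h1|h1] := h.
    have bT : b by apply/(hb (s0 + s1)%N%:Z); [lia|apply: h1; lia].
    (* A shift by twice [s1] moves the interval of possible exceptions off itself, so the two
       translates cover all integers. *)
    split=> // _; exists (s1 + s1)%N%:Z => s.
    have [hs|hs] := lerP s1%:Z `|s|; first by left; exact: h1.
    by right; apply: h1; lia.
  have nb : ~ b by move/(hb (s0 + s1)%N%:Z) => hR; apply: (h1 (s0 + s1)%N%:Z); [lia|apply: hR; lia].
  (* The chosen point and its translate by [- c] are both at least [s1], where [R t] fails. *)
  split=> // -[c /(_ (s1%:Z + `|c|))[]] hR; [case: (h1 _ _ hR)|case: (h1 _ _ hR)]; lia.
apply: nltS; apply: (has_lt_ends addS (T := T) (K := K.+1)) => [|t ht|t ht].
- apply: dpred_ex; apply: dpred_all; apply: dpred_or.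
    apply: (dpred_subst (g := fun z : int * int * int => (z.1.1, z.2))) (dpred_plane _ _).
    move=> v [[v' -> ->]|[v' -> ->]] /=; apply: dfun_var; last by right; exists id.
    by left; exists fst => //; left; exists id.
  apply: (dpred_subst (g := fun z : int * int * int => (z.1.1, z.2 - z.1.2))) (dpred_plane _ _).
  move=> v [[v' -> ->]|[v' -> ->]] /=.
    by apply: dfun_var; left; exists fst => //; left; exists id.
  apply: (dfunB addS); apply: dfun_var; first by right; exists id.
  by left; exists snd => //; right; exists id.
- have [s0 hs0] := crossing Ww Ww' Wu hu gw1 hw1 ht.
  exact/(TE t s0 _ hs0).
- have hu' i : nonconst i -> g i u = 0 -> (0 < g i w') != (0 < g i w) /\ g i w' != 0 /\ g i w != 0.
    by move=> nci /(hu i nci)[h [h1 h2]]; rewrite eq_sym.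
  have [|s0 hs0] := crossing Ww' Ww Wu hu' gw1' hw1' (t := - t); first lia.
  have hs1 (s : int) : s0%:Z <= s -> R t s <-> chamber w1'.
    by move=> /hs0; rewrite scaleNr -scalerN opprB.
  by move/(TE _ _ _ hs1).
Qed.

(** Induction on the number of hyperplanes separating [w] from [w']. If i is one of them and [u] a
    direction between the two inside it, go from [w] to [w1] near [u], across to [w1'], and on to
    [w']. The outer moves cross only hyperplanes that separate [w] from [w'], and not i; the middle
    one is [chamber_const_step]. *)
Lemma chamber_const w w' : generic w -> generic w' -> chamber w -> chamber w'.
Proof.
have [k] := ubnP #|separated w w'|.
elim: k w w' => // k IH w w' hk gw gw' cw.
have [i /andP[/asboolP nci hi]|hsep] := pickP (separated w w'); last first.
  apply: (iffLR (chamber_same_side gw gw' _) cw) => i nci.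
  by have := hsep i; rewrite /separated; case: asboolP => //= _ /negbFE/eqP.
(* The weights make [g i u] vanish, since [g i w] and [g i w'] have opposite signs. *)
pose u := `|g i w'| *: w + `|g i w| *: w'.
have [[Ww hw] [Ww' hw']] := (gw, gw').
have Wu : W u by apply: directionD; exact: directionZ.
have gu j : g j u = `|g i w'|%:Z * g j w + `|g i w|%:Z * g j w'.
  by rewrite gD !gZ.
(* Adding H times [u] gives each form the sign it has on [u], unless it vanishes there. *)
pose H := (\sum_j (`|g j w| + `|g j w'|)).+1.
have hH j : `|g j w| < H%:Z /\ `|g j w'| < H%:Z.
  by have := sum_ge (fun j => `|g j w| + `|g j w'|)%N j; rewrite /H; lia.
pose w1 := w + H%:Z *: u; pose w1' := w' + H%:Z *: u.
have [gi gi'] : g i w != 0 /\ g i w' != 0 by split; apply/eqP; [exact: hw|exact: hw'].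
have gw1 : generic w1.
  split=> [|j ncj]; first by apply: directionD => //; exact: directionZ.
  by rewrite gD gZ; apply/eqP/(gt0_line _ (hH j).1).2/eqP/hw.
have gw1' : generic w1'.
  split=> [|j ncj]; first by apply: directionD => //; exact: directionZ.
  by rewrite gD gZ; apply/eqP/(gt0_line _ (hH j).2).2/eqP/hw'.
have s1 j : (0 < g j w1) = if g j u == 0 then 0 < g j w else 0 < g j u.
  by rewrite gD gZ (gt0_line _ (hH j).1).1.
have s1' j : (0 < g j w1') = if g j u == 0 then 0 < g j w' else 0 < g j u.
  by rewrite gD gZ (gt0_line _ (hH j).2).1.
have gui : g i u = 0 by rewrite gu; move: hi gi gi'; nia.
have sep_lt v v' : generic v -> generic v' ->
    (forall j, separated v v' j -> separated w w' j && (j != i)) ->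
    (#|separated v v'| < k)%N.
  move=> gv gv' hv; apply: leq_trans (_ : #|separated w w'| <= k)%N => //.
  apply: proper_card; apply/properP; split; first by apply/fintype.subsetP => j /hv/andP[].
  by exists i; [apply/andP; split=> //; exact/asboolP|apply/negP => /hv; rewrite eqxx andbF].
have sgu j : nonconst j -> (0 < g j w) = (0 < g j w') -> g j u != 0 /\ (0 < g j u) = (0 < g j w).
  by move=> ncj hj; have := hw j ncj; have := hw' j ncj; rewrite gu; move: gi gi' hj; nia.
have cw1 : chamber w1.
  apply: (IH w w1 _ gw gw1 cw); apply: sep_lt => // j /andP[ncj].
  rewrite s1 /separated ncj /=; have [->|ji] := eqVneq j i; first by rewrite gui !eqxx.
  rewrite andbT; case: (g j u =P 0) => [_|_]; first by rewrite eqxx.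
  by apply: contra => /eqP hj; have [_ ->] := sgu j (asboolW ncj) hj.
have cw1' : chamber w1'.
  apply: chamber_const_step Ww Ww' Wu _ gw1 gw1' (fun j _ => s1 j) (fun j _ => s1' j) cw1.
  move=> j ncj ju; split; last by split; apply/eqP; [exact: hw|exact: hw'].
  by apply/negP => /eqP /(sgu j ncj)[]; rewrite ju.
apply: (IH w1' w' _ gw1' gw' cw1'); apply: sep_lt => // j /andP[ncj].
rewrite s1' /separated ncj /=; have [->|ji] := eqVneq j i; first by rewrite gui !eqxx.
rewrite andbT; case: (g j u =P 0) => [_|_]; first by rewrite eqxx.
by apply: contra => /eqP hj; have [_ ->] := sgu j (asboolW ncj) hj; rewrite hj.
Qed.

End Flat.

(** Induction on the number of forms outside [E]. If one chamber lies in [A], all do by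
    [chamber_const], so the complement of [A] stays in the strips; otherwise [A] itself does. In
    both cases [dpred_strips] reduces to smaller flats. *)
Lemma dpred_flat E p : dpred Zgroup (fun x => A x /\ direction E (x - p)).
Proof.
have [k] := ubnP #|~: E|; elim: k E p => // k IH E p hk.
have IH' i q : i \notin E -> dpred Zgroup (fun x => A x /\ direction (i |: E) (x - q)).
  move=> iE; apply: IH; apply: leq_trans (_ : #|~: E| <= k)%N => //.
  apply: proper_card; rewrite finset.setCU; apply/properP; split; first exact: finset.subsetIr.
  by exists i; rewrite !inE ?eqxx.
have hdeep B : (forall w, generic E w -> B (p + (\sum_i `|(g i p + d i)%R|%N).+1%:Z *: w) -> False) ->
  (forall x w, generic E w -> deep E p (x - p) -> B x -> same_side E (x - p) w ->
     B (p + (\sum_i `|(g i p + d i)%R|%N).+1%:Z *: w)) ->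
  forall x, direction E (x - p) -> B x ->
     exists2 i, nonconst E i & (`|g i (x - p)| <= \sum_i `|(g i p + d i)%R|%N)%N.
  move=> hB hB' x Wx Bx; apply: contrapT => hx.
  have dx : deep E p (x - p).
    by split=> // i nci; rewrite ltnNge; apply/negP => ?; apply: hx; exists i.
  have gx : generic E (x - p).
    by split=> // i nci gi; have := dx.2 i nci; rewrite gi.
  by apply: (hB _ gx); apply: (hB' x).
have [[w0 [gw0 cw0]]|nc] := EM (exists w, generic E w /\ chamber p w).
  have hall w : generic E w -> chamber p w by move=> gw; exact: chamber_const gw0 gw cw0.
  have hN : dpred Zgroup (fun x => ~ A x /\ direction E (x - p)).
    apply: (dpred_strips (p := p)) => [i q iE|].
      apply: eq_dpred (dpred_and (dpred_direction q (i |: E)) (dpred_not (IH' i q iE))) => x; tauto.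
    apply: (hdeep (fun x => ~ A x)) => [w /hall//|x w gw dx nAx ss].
    by have [_ h] := chamberE gw dx (same_sideC ss); rewrite addrC subrK in h => /h.
  apply: eq_dpred (dpred_and (dpred_direction p E) (dpred_not hN)) => x.
  by have := EM (A x); tauto.
apply: (dpred_strips (p := p)) => //.
apply: hdeep => [w gw cw|x w gw dx Ax ss]; first by apply: nc; exists w.
have [h _] := chamberE gw dx (same_sideC ss); rewrite addrC subrK in h.
exact: h.
Qed.

End Dichotomy.

Lemma Presburger_dichotomy L (S : structure L int) (addS : has_add S) n
    (A : n.-tuple int -> Prop) :
  dpred S A -> dpred Presburger A -> dpred Zgroup A \/ has_lt S.
Proof.
move=> dSA dPA; have [ltS|nltS] := EM (has_lt S); [by right|left].
pose tup (x : 'rV[int]_n) := [tuple x ord0 i | i < n].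
have htup v : vars v -> vars (fun x => v (tup x)).
  by move=> [i ->]; exists i; apply/funext => x; rewrite tnth_mktuple.
have dSB : dpred S (fun x => A (tup x)) by apply: dpred_pull dSA => v /htup; left.
have [m [I [l [m0 hl hA]]]] : qfree (fun x => A (tup x)).
  by apply: qfree_pull (dpred_qfree dPA) => v /htup/aff_var.
have /choice[g /choice[d hg]] i := aff_rV (hl i).
suff dB : @dpred _ Zgroup _ (@ctx_rV n) (fun x => A (tup x)).
  pose row (e : n.-tuple int) : 'rV[int]_n := \row_i tnth e i.
  apply: eq_dpred (dpred_pull (g := row) _ dB) => [e|v [i ->]].
    by rewrite (_ : tup _ = e)//; apply: eq_from_tnth => i; rewrite tnth_mktuple mxE.
  by left; exists i; apply/funext => e; rewrite mxE.
have hA' x y : cong m x y -> (forall i, (0 <= g i x + d i) = (0 <= g i y + d i)) ->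
    A (tup x) -> A (tup y).
  by move=> xy gxy; apply: hA => // i; have [_ e _ _] := hg i; rewrite !e.
have dflat := dpred_flat addS nltS dSB m0 (fun i => let: And4 a _ _ _ := hg i in a)
  (fun i => let: And4 _ _ a _ := hg i in a) (fun i => let: And4 _ _ _ a := hg i in a) hA'.
(* The flats for the empty set of forms are the cosets of the multiples of [m]; the vectors with
   entries below [m] represent them all. *)
apply: eq_dpred (dpred_ex_mem (enum {ffun 'I_n -> 'I_m}) (fun q => dflat finset.set0 (\row_i (q i)%:Z))) => x.
split=> [[q _ []]//|Ax].
have lt k : (`|(x ord0 k %% m)%Z|%N < m)%N.
  by rewrite -ltz_nat gez0_abs ?ltz_pmod ?modz_ge0 // -lt0n.
exists [ffun k => Ordinal (lt k)]; first by rewrite mem_enum.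
split=> //; split=> k; last by rewrite finset.in_set0.
rewrite !mxE ffunE /= gez0_abs ?modz_ge0 -?lt0n//.
by rewrite {1}(divz_eq (x ord0 k) m) addrK dvdz_mull.
Qed.

Lemma definable_dichotomy n (A : set (n.-tuple int)) : definable Presburger A ->
  definable Zgroup A \/ has_lt (add_rel Zgroup A).
Proof.
move=> /definable_dpred dA.
have [h|] := Presburger_dichotomy (has_add_rel A) (dpred_rel A) dA; last by right.
by left; apply/definable_dpred.
Qed.

Lemma expansion_dichotomy L (S : structure L int) (expS : is_expansion S Zgroup) n
    (A : set (n.-tuple int)) :
  definable S A -> definable Presburger A -> definable Zgroup A \/ has_lt S.
Proof.
move=> /definable_dpred dSA /definable_dichotomy[|ltA]; [by left|right].
exact: dpred_from_rel (has_add_expansion expS) _ _ dSA _ _ _ ltA.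
Qed.

Lemma has_lt_unstable L (S : structure L int) : has_lt S -> ~ stable S.
Proof.
move=> /dpred_instance[m [phi [b hb]]] /(_ _ _ phi); apply.
exists int, S, (fun i => [tuple i%:Z]), (fun j => b j%:Z); split=> // i j.
by rewrite -hb /= ltz_nat.
Qed.

(** * Patterns from finite arrays *)

Lemma tuple1E T (x : 1.-tuple T) : x = [tuple thead x].
Proof. by apply: eq_from_tnth => i; rewrite ord1 tnth0. Qed.

Section Ultrapower.
Local Open Scope nat_scope.
Local Open Scope classical_set_scope.
Variables (L : language) (M : Type) (S : structure L M) (x0 : M).
Variables (U : set_system nat) (UU : UltraFilter U).

Let FU : Filter U := @filter_filter _ _ (@ultra_proper _ _ UU).
Let US (P Q : set nat) := @filterS _ _ FU P Q.
Let US2 (P Q R : set nat) := @filterS2 _ _ FU P Q R.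
Let US3 (P Q R T : set nat) := @filterS3 _ _ FU P Q R T.
Let Uall (I : finType) (P : I -> set nat) := @filter_forall _ I P _ FU.

Definition almost_eq (f g : nat -> M) : Prop := U [set k | f k = g k].

(** Points are the equivalence classes themselves, as sets of sequences. Representatives are chosen
    by [rep], and the symbols are interpreted through them. *)
Definition ultrapower := {C : set (nat -> M) | exists f, C = almost_eq f}.

Definition class_of (f : nat -> M) : ultrapower :=
  exist _ (almost_eq f) (ex_intro _ f erefl).

Definition rep (C : ultrapower) : nat -> M := projT1 (cid (proj2_sig C)).

Lemma almost_eq_refl f : almost_eq f f.
Proof. by rewrite /almost_eq; apply: US (@filterT _ _ FU) => k. Qed.

Lemma almost_eqP f g : almost_eq f g <-> almost_eq f = almost_eq g.
Proof.
split=> [fg|->]; last exact: almost_eq_refl.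
apply/funext => h; apply/propext; split; apply: US2 fg => k /= -> //.
Qed.

Lemma repK C : class_of (rep C) = C.
Proof.
case: C => C hC; apply: eq_exist; rewrite /rep /=.
by case: cid.
Qed.

Lemma class_ofK f : almost_eq (rep (class_of f)) f.
Proof.
apply/almost_eqP; apply/esym.
by rewrite /rep; case: cid.
Qed.

Lemma class_of_eq f g : class_of f = class_of g <-> almost_eq f g.
Proof.
split=> [[/almost_eqP//]|/almost_eqP fg].
exact: eq_exist.
Qed.

Definition ultra_structure : structure L ultrapower :=
  @Structure L ultrapower
    (fun f t => class_of (fun k => finterp S [tuple rep (tnth t i) k | i < farity f]))
    (fun r t => U [set k | rinterp S [tuple rep (tnth t i) k | i < rarity r]]).

Definition coord n (e : n.-tuple ultrapower) k := [tuple rep (tnth e i) k | i < n].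

Lemma rep_eval n (e : n.-tuple ultrapower) (t : term L n) :
  almost_eq (rep (eval ultra_structure e t)) (fun k => eval S (coord e k) t).
Proof.
elim: t => [i|f ts IH] /=.
  by apply: US (@filterT _ _ FU) => k _ /=; rewrite tnth_mktuple.
have h := Uall IH.
pose a := [tuple eval ultra_structure e (ts i) | i < farity f].
apply: US2 h (class_ofK (fun k => finterp S [tuple rep (tnth a i) k | i < farity f])) => k hk /= ->.
by congr (finterp S _); apply: eq_from_tnth => i; rewrite !tnth_mktuple hk.
Qed.

(** Łoś's theorem, by induction on the formula; implication and quantifier use that [U] contains a
    set or its complement. *)
Lemma sat_ultrapower n (phi : formula L n) (e : n.-tuple ultrapower) :
  sat ultra_structure phi e <-> U [set k | sat S phi (coord e k)].
Proof.
elim: phi e => {n} [n|n t u|n r ts|n phi IHphi psi IHpsi|n phi IH] e /=.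
- by split=> // /filter_not_empty.
- rewrite -[X in X = _]repK -[X in _ = X]repK class_of_eq.
  split; apply: US3 (rep_eval e t) (rep_eval e u) => k /= -> -> //.
- have h := Uall (fun i => rep_eval e (ts i)).
  have e' k : (forall i, rep (eval ultra_structure e (ts i)) k = eval S (coord e k) (ts i)) ->
     [tuple rep (tnth [tuple eval ultra_structure e (ts i) | i < rarity r] i) k | i < rarity r]
      = [tuple eval S (coord e k) (ts i) | i < rarity r].
    by move=> hk; apply: eq_from_tnth => i; rewrite !tnth_mktuple hk.
  by split; apply: US2 h => k /= /e' ->.
- rewrite IHphi IHpsi; split=> [h|h h']; last first.
    by apply: US2 h h' => k /=; exact.
  have [/h|] := in_ultra_setVsetC [set k | sat S phi (coord e k)] UU.
    by apply: US => k /= hk _.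
  by apply: US => k /= nk /nk.
- have coord_cons f k : coord [tuple of class_of f :: e] k =
      [tuple of rep (class_of f) k :: coord e k].
    apply: eq_from_tnth => i; rewrite tnth_mktuple.
    by case: (unliftP ord0 i) => [j ->|->]; rewrite ?tnth0 ?tnthS ?tnth_mktuple.
  split=> [h|h a]; last first.
    rewrite IH; apply: US h => k /= hk.
    by rewrite -[a]repK coord_cons.
  have [//|nU] := in_ultra_setVsetC [set k | forall a, sat S phi [tuple of a :: coord e k]] UU.
  (* [f k] is a counterexample in coordinate k if there is one, and the default [x0] otherwise. *)
  have /choice[f hf] k : exists a, sat S phi [tuple of a :: coord e k] ->
      forall a, sat S phi [tuple of a :: coord e k].
    have [ha|/existsNP[a na]] := EM (forall a, sat S phi [tuple of a :: coord e k]).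
      by exists x0.
    by exists a => /na.
  have /IH hS := h (class_of f).
  exfalso; apply: (@filter_not_empty _ U _).
  apply: US3 nU (class_ofK f) hS => k /= nk ek.
  by rewrite coord_cons ek => /hf.
Qed.

Lemma sat_class_of n (phi : formula L n) (f : 'I_n -> nat -> M) :
  sat ultra_structure phi [tuple class_of (f i) | i < n] <->
  U [set k | sat S phi [tuple f i k | i < n]].
Proof.
rewrite sat_ultrapower.
have h := Uall (fun i => class_ofK (f i)).
have e' k : (forall i, rep (class_of (f i)) k = f i k) ->
   coord [tuple class_of (f i) | i < n] k = [tuple f i k | i < n].
  by move=> hk; apply: eq_from_tnth => i; rewrite !tnth_mktuple hk.
by split; apply: US2 h => k /= /e' ->.
Qed.

Lemma ultrapower_model : is_model (theory S) ultra_structure.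
Proof.
move=> phi Tphi; rewrite sat_ultrapower; apply: US (@filterT _ _ FU) => k _ /=.
by rewrite (_ : coord _ _ = [tuple]); [exact: Tphi|exact: tuple0].
Qed.

Lemma instance_ultrapower m (phi : formula L (1 + m)) (b : nat -> m.-tuple M)
    (a : nat -> M) :
  instance ultra_structure phi [tuple class_of (fun k => tnth (b k) l) | l < m]
    [tuple class_of a] <->
  U [set k | instance S phi (b k) [tuple a k]].
Proof.
pose f (i : 'I_(1 + m)) := match split i with inl _ => a | inr l => fun k => tnth (b k) l end.
rewrite /instance /mkset.
rewrite (_ : [tuple of _ ++ _] = [tuple class_of (f i) | i < 1 + m]); last first.
  apply: eq_from_tnth => i; rewrite tnth_mktuple /f.
  case: split_ordP => j ->; last by rewrite tnth_rshift tnth_mktuple.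
  by rewrite tnth_lshift ord1 tnth0.
rewrite sat_class_of.
rewrite (_ : (fun k => sat S phi [tuple f i k | i < 1 + m]) =
  (fun k => sat S phi [tuple of [tuple a k] ++ b k]))//.
apply/funext => k; congr (sat S phi _); apply: eq_from_tnth => i.
rewrite tnth_mktuple /f; case: split_ordP => j ->; last by rewrite tnth_rshift.
by rewrite tnth_lshift ord1 tnth0.
Qed.

End Ultrapower.

Section Arrays.
Local Open Scope nat_scope.
Local Open Scope classical_set_scope.
Variables (L : language) (M : Type) (S : structure L M) (x0 : M).
Variables (m : nat -> nat) (phi : forall i, formula L (1 + m i)).
Variable b : forall d i : nat, nat -> (m i).-tuple M.
Hypothesis disjoint_rows : forall d i j j' x, i < d -> j < d -> j' < d -> j <> j' ->
  instance S (phi i) (b d i j) x -> instance S (phi i) (b d i j') x -> False.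
Hypothesis paths : forall d (h : nat -> nat), (forall i, i < d -> h i < d) ->
  exists x, forall i, i < d -> instance S (phi i) (b d i (h i)) x.

(* Compactness, through an ultrapower: arrays of unbounded finite size yield an
   infinite one. *)
Lemma array_compactness : exists (N : Type) (T : structure L N)
    (c : forall i, nat -> (m i).-tuple N),
  [/\ is_model (theory S) T,
      forall i j j' x, j <> j' -> instance T (phi i) (c i j) x ->
        instance T (phi i) (c i j') x -> False &
      forall h : nat -> nat, consistent (fun i => instance T (phi i) (c i (h i)))].
Proof.
(* As [U] contains all cofinite sets, any fixed finite set of indices lies inside almost all of the
   arrays. *)
have [U [UU Uoo]] := ultraFilterLemma eventually_filter.
have Ugt d : U [set k | d < k] by apply: Uoo; exists d.+1.
exists (ultrapower M U), (ultra_structure S U).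
exists (fun i j => [tuple class_of U (fun k => tnth (b k i j) l) | l < m i]).
have single (x : 1.-tuple (ultrapower M U)) :
    x = [tuple class_of U (rep (thead x))] by rewrite repK; exact: tuple1E.
have US2 := @filterS2 _ _ (@filter_filter _ _ (@ultra_proper _ _ UU)).
have USI P Q : U P -> U Q -> U (P `&` Q) := @filterI _ _ (@filter_filter _ _ (@ultra_proper _ _ UU)) P Q.
split; first exact: ultrapower_model.
  move=> i j j' x jj'; rewrite (single x) => /(instance_ultrapower S x0 UU).
  move=> h1 /(instance_ultrapower S x0 UU) h2.
  apply: (@filter_not_empty _ U _); apply: US2 (USI _ _ h1 h2) (Ugt (i + (j + j'))) => k /= [h1k h2k] hk.
  by apply: (disjoint_rows _ _ _ jj' h1k h2k); lia.
move=> h s.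
(* [f d] realizes the path [h] on the rows of [s] within the array of size d, and is the default
   [x0] if these rows or their columns do not fit. *)
have /choice[f hf] d : exists a, forall i, i \in s -> (forall i', i' \in s -> i' < d /\ h i' < d) ->
    instance S (phi i) (b d i (h i)) [tuple a].
  have [hs|hs] := EM (forall i', i' \in s -> i' < d /\ h i' < d); last by exists x0.
  case: s hs => [|i0 s] hs; first by exists x0.
  have d0 : 0 < d by have := hs i0 (mem_head _ _); lia.
  (* Columns outside the array are replaced by 0, which changes nothing on the rows of [s]. *)
  have [|x hx] := paths (d := d) (h := fun i => if h i < d then h i else 0).
    by move=> i _; case: ifP.
  exists (thead x) => i /hs[id hid] _.
  by have := hx i id; rewrite hid [x in instance _ _ _ x]tuple1E.
exists [tuple class_of U f] => i si; apply/(instance_ultrapower S x0 UU).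
pose bd := \sum_(i' <- s) (i' + h i').
apply: US2 (Ugt bd) (Ugt bd) => d /= hd _; apply: hf => // i' si'.
have : i' + h i' <= bd by rewrite /bd (big_rem i')//= leq_addr.
lia.
Qed.

(** Disjoint rows are 2-inconsistent, which gives the inp-pattern. For two of the rows, a
    realization of a path satisfies no other formula of either row, which gives the ict-pattern. *)
Lemma array_patterns :
  infinite_inp_pattern (theory S) /\ ict_pattern (theory S) 2.
Proof.
have [N [T [c [modT disj cons]]]] := array_compactness.
split.
  exists 1, m, phi, (fun=> 2), N, T, c; split=> // i [|j [|j' []]]//= /andP[jj' _] _ [x hx].
  apply: (disj i j j' x); try by apply: hx; rewrite !inE eqxx ?orbT.
  by move=> jE; rewrite jE inE eqxx in jj'.
exists (fun i : 'I_2 => m i), (fun i : 'I_2 => phi i), N, T, (fun i : 'I_2 => c i); split=> // h s.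
have [x hx] := cons (fun i => h (inord i)) (iota 0 2).
have {}hx (i : 'I_2) : instance T (phi i) (c i (h i)) x.
  by have := hx i; rewrite inord_val mem_iota; apply; rewrite ltn_ord.
exists x => -[i j] _ /=; case: eqP => [->|jh]; first exact: hx.
by move=> hj; exact: disj jh hj (hx i).
Qed.

End Arrays.

(** * Patterns from families with large gaps *)

Definition spread (N : int) (P : int -> Prop) :=
  forall a b, P a -> P b -> a <> b -> N < `|a - b|.

(** The first component refutes strength and the second dp-minimality. *)
Definition patterned L (S : structure L int) :=
  infinite_inp_pattern (theory S) /\ ict_pattern (theory S) 2.

Section SpreadFamily.
Variables (L : language) (S : structure L int) (addS : has_add S) (ltS : has_lt S).
Variables (X : Type) (cX : Ctx X) (F : X * int -> Prop) (dF : dpred S F).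

Let stream := nat -> X * int.

(* [e] lists scales [(x_0, N_0), (x_1, N_1), ...]; [digit i z e a] says that in
   an expansion z = a_0 + a_1 + ... with a_k in F_(x_k) and all remainders
   a_(k+1) + a_(k+2) + ... of size at most N_k, the digit a_i is [a]. *)
Fixpoint digit (i : nat) (z : int) (e : stream) (a : int) : Prop :=
  if i is i'.+1 then
    exists b, F ((e 0%N).1, b) /\ `|z - b| <= (e 0%N).2 /\
      digit i' (z - b) (fun k => e k.+1) a
  else F ((e 0%N).1, a) /\ `|z - a| <= (e 0%N).2.

(** Gaps of more than twice the scale leave at most one member within the scale of a given integer,
    which makes digits unique. *)
Definition wide (xN : X * int) := spread (xN.2 + xN.2) (fun a => F (xN.1, a)).

Lemma digit_unique i z (e : stream) a a' : (forall k, (k <= i)%N -> wide (e k)) ->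
  digit i z e a -> digit i z e a' -> a = a'.
Proof.
have near0 b b' : wide (e 0%N) -> F ((e 0%N).1, b) -> F ((e 0%N).1, b') ->
    `|z - b| <= (e 0%N).2 -> `|z - b'| <= (e 0%N).2 -> b = b'.
  move=> w0 Fb Fb' zb zb'; apply: contrapT => /(w0 _ _ Fb Fb'); lia.
elim: i z e near0 => [|i IH] z e near0 he /=.
  by move=> [Fa za] [Fa' za']; apply: near0 => //; exact: he.
move=> [b [Fb [zb hb]]] [b' [Fb' [zb' hb']]].
have bb' : b = b' by apply: near0 => //; exact: he.
rewrite -bb' in hb'; apply: IH hb hb'; last by move=> k ki; exact: he.
move=> c c' w1 Fc Fc' zc zc'; apply: contrapT => /(w1 _ _ Fc Fc'); lia.
Qed.

Lemma dpred_near Y (cY : Ctx Y) (f g h : Y -> int) :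
  dfun S f -> dfun S g -> dfun S h -> dpred S (fun y => `|f y - g y| <= h y).
Proof.
move=> hf hg hh.
apply: eq_dpred (dpred_and (dpred_le ltS (dfunB addS hf hg) hh)
  (dpred_le ltS (dfunB addS hg hf) hh)) => y; lia.
Qed.

Lemma vars_stream k v : vars v -> dfun S (fun w : int * (stream * int) => v (w.2.1 k)).
Proof.
move=> hv; apply: dfun_var; right; exists (fun y : stream * int => v (y.1 k)) => //.
by left; exists (fun e : stream => v (e k)) => //; exists k, v.
Qed.

(** The formula for [digit i] reads only the first i + 1 entries of the stream, but the stream
    context gives the formulas of all rows one common type of parameters. *)
Lemma dpred_digit i :
  dpred S (fun w : int * (stream * int) => digit i w.1 w.2.1 w.2.2).
Proof.
have dz : dfun S (fun w : int * (stream * int) => w.1).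
  by apply: dfun_var; left; exists id.
have da : dfun S (fun w : int * (stream * int) => w.2.2).
  by apply: dfun_var; right; exists snd => //; right; exists id.
have dN : dfun S (fun w : int * (stream * int) => (w.2.1 0%N).2).
  by apply: (vars_stream 0 (v := snd)); right; exists id.
have dFst v : vars v -> dfun S (fun w : int * (stream * int) => v (w.2.1 0%N).1).
  by move=> hv; apply: (vars_stream 0 (v := fun x => v x.1)); left; exists v.
elim: i => [|i IH] /=.
  apply: dpred_and; last exact: dpred_near.
  apply: (dpred_subst (g := fun w : int * (stream * int) => ((w.2.1 0%N).1, w.2.2))) dF.
  by move=> v [[u hu ->]|[u -> ->]] //=; exact: dFst.
apply: dpred_ex; apply: dpred_and; last apply: dpred_and.
- apply: (dpred_subst (g := fun w : int * (stream * int) * int => ((w.1.2.1 0%N).1, w.2))) dF.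
  move=> v [[u hu ->]|[u -> ->]] /=; last by apply: dfun_var; right; exists id.
  exact: (dfun_dom _ (dFst u hu)).
- apply: dpred_near; [exact: (dfun_dom _ dz)| |exact: (dfun_dom _ dN)].
  by apply: dfun_var; right; exists id.
apply: (dpred_subst (g := fun w : int * (stream * int) * int =>
  (w.1.1 - w.2, ((fun k => w.1.2.1 k.+1), w.1.2.2)))) IH.
move=> v [[u -> ->]|[u [[u' [k [u'' hu'' ->]] ->]|[u' -> ->]] ->]] /=.
- apply: (dfunB addS); first exact: (dfun_dom _ dz).
  by apply: dfun_var; right; exists id.
- exact: (dfun_dom _ (vars_stream k.+1 hu'')).
- exact: (dfun_dom _ da).
Qed.

Hypothesis spreadF : forall N K : nat, exists x,
  spread N%:Z (fun a => F (x, a)) /\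
  exists s : seq int, [/\ uniq s, size s = K & forall a, a \in s -> F (x, a)].

Lemma digit_array (w d : nat) : exists (e : stream) (a : nat -> nat -> int) (B : nat),
  [/\ forall i, (i < d)%N -> wide (e i),
      forall i j j', (i < d)%N -> (j < w)%N -> (j' < w)%N -> j <> j' -> a i j <> a i j' &
      forall h, (forall i, (i < d)%N -> (h i < w)%N) ->
        exists z, `|z| <= B%:Z /\ forall i, (i < d)%N -> digit i z e (a i (h i))].
Proof.
elim: d => [|d [e [a [B [he ha hz]]]]].
  have [x _] := spreadF 0 0.
  by exists (fun=> (x, 0)), (fun=> fun=> 0), 0%N; split=> // h _; exists 0.
have [x [sx [s [us ss Fs]]]] := spreadF (B + B) w.
exists (fun k => if k is k'.+1 then e k' else (x, B%:Z)).
exists (fun i => if i is i'.+1 then a i' else fun j => s`_j).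
exists (B + \sum_(y <- s) `|y|)%N; split.
- by case=> [_|i /he]//; rewrite /wide /= -PoszD.
- case=> [|i] j j' //= id jw j'w jj'; last exact: ha.
  by move/eqP; rewrite nth_uniq ?ss// => /eqP.
move=> h hw; have [|z [zB hz']] := hz (fun i => h i.+1); first by move=> i id; exact: (hw i.+1).
have h0 : s`_(h 0%N) \in s by rewrite mem_nth// ss hw.
exists (s`_(h 0%N) + z); split.
  move: (s`_(h 0%N)) h0 => c /(big_rem c) sc.
  have : (`|c| <= \sum_(y <- s) `|y|)%N by rewrite sc leq_addr.
  lia.
have addKz : s`_(h 0%N) + z - s`_(h 0%N) = z by rewrite addrC addKr.
case=> [_|i id] /=; first by rewrite addKz; split=> //; exact: Fs.
by exists s`_(h 0%N); rewrite addKz; split; [exact: Fs|split=> //; exact: hz'].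
Qed.

(** Row i, column j of the array says that digit i equals [a i j]. Rows are disjoint because digits
    are unique, and paths are consistent because digits can be prescribed. *)
Lemma spread_patterned : patterned S.
Proof.
have /choice[p hp] i : exists p : {m & (formula L (1 + m) * (stream * int -> m.-tuple int))%type},
    forall z y, digit i z y.1 y.2 = instance S (projT2 p).1 ((projT2 p).2 y) [tuple z].
  have [m [phi [b hb]]] := dpred_instance (dpred_digit i).
  by exists (existT _ m (phi, b)).
have /choice[e /choice[a hea]] d := digit_array d d.
apply: (array_patterns 0 (m := fun i => projT1 (p i)) (phi := fun i => (projT2 (p i)).1)
  (b := fun d i j => (projT2 (p i)).2 (e d, a d i j))) => [d i j j' x id jd j'd jj'|d h hd].
  have [B [he ha _]] := hea d.
  rewrite (tuple1E x) -(hp i _ (e d, a d i j)) -(hp i _ (e d, a d i j')) => h1 h2.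
  apply: (ha i j j' id jd j'd jj'); apply: digit_unique h1 h2 => k ki.
  by apply: he; exact: leq_ltn_trans id.
have [B [_ _ hz]] := hea d.
have [z [_ hz']] := hz h hd.
by exists [tuple z] => i id; rewrite -(hp i _ (e d, a d i (h i))); exact: hz'.
Qed.

End SpreadFamily.

(** * Uniform bounds in the absence of patterns *)

Definition few (K : nat) (P : int -> Prop) :=
  exists2 s : seq int, (size s <= K)%N & forall t, P t -> t \in s.

Lemma few_uniq K (P : int -> Prop) :
  (forall s : seq int, uniq s -> (forall t, t \in s -> P t) -> (size s <= K)%N) -> few K P.
Proof.
move=> hP.
pose Q n := `[< exists s : seq int, [/\ uniq s, forall t, t \in s -> P t & size s = n] >].
have Q0 : exists n, Q n by exists 0%N; apply/asboolP; exists [::].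
have QK n : Q n -> (n <= K)%N by move=> /asboolP[s [us sP <-]]; exact: hP.
have [n /asboolP[s [us sP sn]] nmax] := ex_maxnP Q0 QK.
exists s => [|t Pt]; first exact: hP.
apply: contrapT => /negP ts; have : (n.+1 <= n)%N; last by rewrite ltnn.
apply: nmax; apply/asboolP; exists (t :: s); rewrite /= ts sn; split=> // t'.
by rewrite inE => /predU1P[->|/sP].
Qed.

Lemma few_sub K (P Q : int -> Prop) : (forall t, P t -> Q t) -> few K Q -> few K P.
Proof. by move=> PQ [s sK hs]; exists s => // t /PQ/hs. Qed.

Lemma few_or K K' (P Q : int -> Prop) :
  few K P -> few K' Q -> few (K + K') (fun t => P t \/ Q t).
Proof.
move=> [s sK hs] [s' sK' hs']; exists (s ++ s'); first by rewrite size_cat leq_add.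
by move=> t; rewrite mem_cat => -[/hs ->//|/hs' ->]; rewrite orbT.
Qed.

Lemma few_shift K c (P : int -> Prop) : few K P -> few K (fun t => P (t + c)).
Proof.
move=> [s sK hs]; exists [seq t - c | t <- s]; first by rewrite size_map.
by move=> t /hs ts; apply/mapP; exists (t + c); rewrite ?addrK.
Qed.

Lemma few_ex (J : eqType) (js : seq J) K (P : J -> int -> Prop) :
  (forall j, few K (P j)) -> few (size js * K) (fun t => exists2 j, j \in js & P j t).
Proof.
move=> hP; elim: js => [|j js IH]; first by exists [::] => // t [].
apply: few_sub (few_or (hP j) IH) => t [k]; rewrite inE => /predU1P[->|kjs] Pk.
  by left.
by right; exists k.
Qed.

Lemma few_seq (s : seq int) : few (size s) (fun t => t \in s).
Proof. by exists s. Qed.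

Section Unpatterned.
Variables (L : language) (S : structure L int) (addS : has_add S) (ltS : has_lt S).
Hypothesis noS : ~ patterned S.

Lemma spread_bound X (cX : Ctx X) (F : X * int -> Prop) : dpred S F ->
  exists N K : nat, forall x, spread N%:Z (fun a => F (x, a)) ->
    forall s : seq int, uniq s -> (forall a, a \in s -> F (x, a)) -> (size s <= K)%N.
Proof.
move=> dF; apply: contrapT => h; apply: noS; apply: (spread_patterned addS ltS dF) => N K.
apply: contrapT => h'; apply: h; exists N, K => x sx s us Fs.
rewrite leqNgt; apply/negP => Ks; apply: h'; exists x; split=> //.
exists (take K s); split; first exact: take_uniq.
  by rewrite size_take Ks.
by move=> a /mem_take/Fs.
Qed.

(* With q = N!, a word of length q + 1 that occurs at two places at distance at
   most N begins and ends with the same letter; other words occur boundedly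
   often. *)
Lemma few_nonperiodic X (cX : Ctx X) (P : X * int -> Prop) : dpred S P ->
  exists (q K : nat), (0 < q)%N /\
    forall x, few K (fun t => ~ (P (x, t) <-> P (x, t + q%:Z))).
Proof.
move=> dP.
pose F (y : X * int * int * int) := forall i, 0 <= i -> i < y.1.2 ->
  (P (y.1.1.1, y.2 + i) <-> P (y.1.1.1, y.1.1.2 + i)).
have dF : dpred S F.
  apply: dpred_all.
  have dx v : vars v -> dfun S (fun z : X * int * int * int * int => v z.1.1.1.1).
      by move=> hv; dproj; exact: dfun_var.
  apply: dpred_imp; first by apply: (dpred_le ltS); [exact: dfun_cst|dproj].
  apply: dpred_imp; first by apply: (dpred_lt ltS); dproj.
  apply: dpred_iff.
    apply: (dpred_subst (g := fun z : X * int * int * int * int => (z.1.1.1.1, z.1.2 + z.2))) dP.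
    by move=> v [[u hu ->]|[u -> ->]] /=; [exact: dx|by apply: (dfunD addS); dproj].
  apply: (dpred_subst (g := fun z : X * int * int * int * int => (z.1.1.1.1, z.1.1.1.2 + z.2))) dP.
  by move=> v [[u hu ->]|[u -> ->]] /=; [exact: dx|by apply: (dfunD addS); dproj].
have [N [K hK]] := spread_bound dF.
pose q := N`!.
exists q, (size (enum {ffun 'I_q.+1 -> bool}) * K)%N; split=> [|x]; first exact: fact_gt0.
pose word t : {ffun 'I_q.+1 -> bool} := [ffun i : 'I_q.+1 => `[< P (x, t + i%:Z) >]].
apply: few_sub (few_ex (K := K) (enum {ffun 'I_q.+1 -> bool}) (P := fun W t =>
  ~ (P (x, t) <-> P (x, t + q%:Z)) /\ W = word t) _) => [t ht|W].
  by exists (word t); rewrite ?mem_enum.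
apply: few_uniq => -[//|m s] us hs.
have [hm Wm] := hs m (mem_head _ _).
have wordE t : word t = word m -> forall i, 0 <= i -> i < q.+1%:Z -> (P (x, t + i) <-> P (x, m + i)).
  move=> tm i i0 iq; have iq' : (`|i| < q.+1)%N by lia.
  have := congr1 (fun W : {ffun 'I_q.+1 -> bool} => W (Ordinal iq')) tm.
  rewrite !ffunE /= gez0_abs// => e.
  by split=> /asboolP h; apply/asboolP; [rewrite -e|rewrite e].
apply: (hK (x, m, q.+1%:Z)) => // [a b Fa Fb ab|t ts]; last first.
  by have [_ Wt] := hs t ts; apply: wordE; rewrite -Wt.
rewrite ltNge; apply/negP => abN; apply: hm.
wlog ltab : a b Fa Fb ab abN / a < b.
  move=> h; have [/h|/h|//] := ltrgtP a b; first exact.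
  by apply=> //; [apply/nesym|rewrite distrC].
have [dl [bE dl0 dlN]] : exists dl : nat, [/\ b = a + dl%:Z, (0 < dl)%N & (dl <= N)%N].
  by exists `|(b - a)%R|%N; split; lia.
have [k qE] : exists k, q = (k * dl)%N by apply/dvdnP; rewrite dvdn_fact// dl0.
have step j : (j <= k)%N -> (P (x, m) <-> P (x, m + (j * dl)%N%:Z)).
  elim: j => [|j IH] jk; first by rewrite mul0n addr0.
  have jq : (j.+1 * dl <= q)%N by rewrite qE leq_mul2r jk orbT.
  rewrite IH; last exact: ltnW.
  rewrite -(Fb (j * dl)%N%:Z) //; last by rewrite /=; lia.
  rewrite -(Fa (j.+1 * dl)%N%:Z) //.
  by rewrite /= bE (_ : a + dl%:Z + _ = a + (j.+1 * dl)%N%:Z)//; lia.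
by rewrite qE; exact: step.
Qed.

Lemma increasing_steps (y : nat -> int) (N k : nat) :
  (forall i, (i < k)%N -> N%:Z < y i.+1 - y i) ->
  forall i j, (i < j)%N -> (j <= k)%N -> N%:Z < y j - y i.
Proof.
move=> hy i; elim=> // j IH; rewrite ltnS leq_eqVlt => /predU1P[->|ij] jk.
  exact: hy.
by have := IH ij (ltnW jk); have := hy j jk; lia.
Qed.

(* A long run of jumps of the same sign would make the image of an arithmetic
   progression a large set with large gaps. *)
Lemma few_jumps X (cX : Ctx X) (f : X * int -> int) : dfun S f ->
  exists (q N K : nat), (0 < q)%N /\
    forall x, few K (fun t => N%:Z < `|f (x, t + q%:Z) - f (x, t)|).
Proof.
move=> df.
have df' Y (cY : Ctx Y) (g : Y -> X) (h : Y -> int) :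
    (forall v, vars v -> dfun S (fun y => v (g y))) -> dfun S h -> dfun S (fun y => f (g y, h y)).
  move=> hg hh; apply: (dfun_subst (g := fun y => (g y, h y))) df => v [[u hu ->]|[u -> ->]] //=.
  exact: hg.
pose P (y : X * int * int * int) := y.1.1.2 < f (y.1.1.1, y.2 + y.1.2) - f (y.1.1.1, y.2).
have dP : dpred S P.
  apply: (dpred_lt ltS); first by dproj.
  have dx v : vars v -> dfun S (fun y : X * int * int * int => v y.1.1.1) by move=> hv; dproj; exact: dfun_var.
  by apply: (dfunB addS); apply: df' => //; first apply: (dfunD addS); dproj.
have [q [K1 [q0 hK1]]] := few_nonperiodic dP.
pose F (y : X * int * int * int) := exists t, y.1.1.2 <= t /\ t <= y.1.2 /\
  (q%:Z %| t - y.1.1.2)%Z /\ y.2 = f (y.1.1.1, t).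
have dF : dpred S F.
  apply: dpred_ex; apply: dpred_and; first by apply: (dpred_le ltS); dproj.
  apply: dpred_and; first by apply: (dpred_le ltS); dproj.
  apply: dpred_and; first by apply: (dpred_modz addS); dproj.
  apply: dpred_eq; first by dproj.
  by apply: df' => [v hv|]; dproj; exact: dfun_var.
have [N [k hk]] := spread_bound dF.
pose J x d t := P (x, N%:Z, d, t).
have run x (d : int) t : d = q%:Z \/ d = - q%:Z ->
    exists2 i, i \in iota 0 k.+1 & J x d t -> J x d (t + i%:Z * d) /\ ~ J x d (t + i.+1%:Z * d).
  move=> hd; apply: contrapT => hrun.
  have hstep i : (i <= k)%N -> J x d t /\ (J x d (t + i%:Z * d) -> J x d (t + i.+1%:Z * d)).
    move=> ik; have hi : ~ (J x d t -> J x d (t + i%:Z * d) /\ ~ J x d (t + i.+1%:Z * d)).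
      by move=> hi; apply: hrun; exists i => //; rewrite mem_iota.
    have [Jt|nJt] := EM (J x d t); last by case: hi.
    split=> // Ji; apply: contrapT => nJ; exact: hi.
  have hJ i : (i <= k)%N -> J x d (t + i%:Z * d).
    elim: i => [|i IH] ik; first by rewrite mul0r addr0; exact: (hstep 0%N ik).1.
    by apply: (hstep i (ltnW ik)).2; apply: IH; exact: ltnW.
  pose y (i : nat) := f (x, t + i%:Z * d).
  have yS i : (i < k.+1)%N -> N%:Z < y i.+1 - y i.
    move=> /hJ; rewrite /J /P /= /y; congr (_ < f (x, _) - _).
    by rewrite intS; ring.
  have ylt := increasing_steps yS.
  have yinj : {in iota 0 k.+2 &, injective y}.
    move=> i j; rewrite !mem_iota => /andP[_ ik] /andP[_ jk] yij.
    have [ij|ji|//] := ltngtP i j.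
      by have := ylt i j ij jk; rewrite yij subrr; lia.
    by have := ylt j i ji ik; rewrite yij subrr; lia.
  have [u [v huv]] : exists u v : int, forall y', F (x, u, v, y') <->
      exists2 i : nat, (i <= k.+1)%N & y' = y i.
    have q0' : 0 < q%:Z by [].
    case: hd => dE.
      exists t, (t + k.+1%:Z * q%:Z) => y'; split=> [[t' [/= h1 [h2 [/dvdzP[e he] ->]]]]|[i ik ->]].
        have e0 : 0 <= e by rewrite -(pmulr_lge0 _ q0') -he; lia.
        have ek : e <= k.+1%:Z by rewrite -(ler_pM2r q0') -he; lia.
        exists `|e|%N; first lia.
        by rewrite /y gez0_abs// dE -he addrC subrK.
      have ikq : i%:Z * q%:Z <= k.+1%:Z * q%:Z by rewrite ler_pM2r.
      exists (t + i%:Z * d); rewrite /= /y dE; split; first by rewrite lerDl mulr_ge0.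
      by rewrite lerD2l; split=> //; split; first by rewrite addrC addKr dvdz_mull.
    exists (t - k.+1%:Z * q%:Z), t => y'; split=> [[t' [/= h1 [h2 [/dvdzP[e he] ->]]]]|[i ik ->]].
      have e0 : 0 <= e by rewrite -(pmulr_lge0 _ q0') -he; lia.
      have ek : e <= k.+1%:Z by rewrite -(ler_pM2r q0') -he; lia.
      exists `|(k.+1%:Z - e)%R|%N; first lia.
      by rewrite /y gez0_abs ?subr_ge0// dE; congr (f (x, _)); move: he; lia.
    have ikq : i%:Z * q%:Z <= k.+1%:Z * q%:Z by rewrite ler_pM2r.
    have iq0 : 0 <= i%:Z * q%:Z by rewrite mulr_ge0.
    exists (t + i%:Z * d); rewrite /= /y dE; split; first by lia.
    split; first by lia.
    split=> //; apply/dvdzP; exists (k.+1%:Z - i%:Z); ring.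
  have := hk (x, u, v) _ [seq y i | i <- iota 0 k.+2].
  rewrite size_map size_iota map_inj_in_uniq// iota_uniq => h.
  suff : (k.+2 <= k)%N by rewrite ltnNge leqnSn.
  apply: h => // [a b|a].
    move=> /huv[i ik ->] /huv[j jk ->] ab.
    have [ij|ji|ij] := ltngtP i j; last by rewrite ij in ab.
      by have := ylt i j ij jk; lia.
    by have := ylt j i ji ik; lia.
  by move=> /mapP[i]; rewrite mem_iota => /andP[_ ik] ->; apply/huv; exists i.
have few_J x d : d = q%:Z \/ d = - q%:Z -> few (k.+1 * K1) (J x d).
  move=> hd; rewrite -[k.+1](size_iota 0).
  pose exc t := ~ (J x d t <-> J x d (t + q%:Z)).
  have [c hc] : exists c : int, forall t, J x d t -> ~ J x d (t + d) -> exc (t + c).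
    case: hd => dE; [exists 0|exists d] => t Jt nJ; rewrite /exc ?addr0 => -[J1 J2].
      by apply: nJ; rewrite {2}dE; exact: J1.
    by apply: nJ; apply: J2; rewrite {2}dE subrK.
  apply: few_sub (few_ex (iota 0 k.+1) (P := fun i t => exc (t + (i%:Z * d + c))) (K := K1) _) => [t Jt|i].
    have [i ik /(_ Jt)[J1 J2]] := run x d t hd; exists i => //.
    rewrite addrA; apply: hc => //.
    by rewrite (_ : t + i%:Z * d + d = t + i.+1%:Z * d)// intS; ring.
  exact: few_shift (hK1 (x, N%:Z, d)).
exists q, N, (k.+1 * K1 + k.+1 * K1)%N; split=> // x.
apply: few_sub (few_or (few_J x q%:Z _) (few_shift q%:Z (few_J x (- q%:Z) _))) => [t|//|//]; [|by left|by right].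
rewrite /J /P /= addrK; lia.
Qed.

(* The difference with step q takes few large values; once truncated it is
   periodic outside few points, and its sums over a period are constant. *)
Lemma few_nonlinear X (cX : Ctx X) (f : X * int -> int) : dfun S f ->
  exists (Q N K : nat), (0 < Q)%N /\
    forall x, few K (fun t => ~ (`|f (x, t) - f (x, t - Q%:Z)| <= N%:Z /\
      f (x, t + Q%:Z) - f (x, t) = f (x, t) - f (x, t - Q%:Z))).
Proof.
move=> df; have [q [N [K [q0 hK]]]] := few_jumps df.
pose P (y : X * int * int) := f (y.1.1, y.2 + q%:Z) - f (y.1.1, y.2) = y.1.2.
have dP : dpred S P.
  apply: dpred_eq; last by dproj.
  apply: (dfunB addS).
    apply: (dfun_subst (g := fun y : X * int * int => (y.1.1, y.2 + q%:Z))) df => v [[u hu ->]|[u -> ->]] /=.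
      by dproj; exact: dfun_var.
    by apply: (dfunD addS); [dproj|exact: dfun_cst].
  apply: (dfun_subst (g := fun y : X * int * int => (y.1.1, y.2))) df => v [[u hu ->]|[u -> ->]] /=; dproj.
  exact: dfun_var.
have [q' [K' [q'0 hK']]] := few_nonperiodic dP.
pose h x t := f (x, t + q%:Z) - f (x, t).
pose big x t := N%:Z < `|h x t|.
pose bad x t := h x t <> h x (t + q'%:Z).
pose rng := [seq i%:Z - N%:Z | i <- iota 0 (N + N).+1].
pose Kbad := (K + size rng * K')%N.
have few_bad x : few Kbad (bad x).
  apply: few_sub (few_or (hK x)
    (few_ex rng (P := fun s t => ~ (P (x, s, t) <-> P (x, s, t + q'%:Z)))
      (fun s => hK' (x, s)))) => t ht.
  have [hN|hN] := ltrP N%:Z `|h x t|; [by left|right].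
  exists (h x t); last by move=> [/(_ erefl) /esym].
  apply/mapP; exists `|(h x t + N%:Z)%R|%N; first by rewrite mem_iota; lia.
  lia.
pose Q := (q' * q)%N; pose g x t := f (x, t + Q%:Z) - f (x, t).
have gE x t : g x t = \sum_(i < q') h x (t + (i * q)%N%:Z).
  rewrite /g /Q; elim: (q') => [|k IH]; first by rewrite big_ord0 mul0n addr0 subrr.
  rewrite big_ord_recr -IH /= /h (_ : t + (k * q)%N%:Z + q%:Z = t + (k.+1 * q)%N%:Z); last by lia.
  by rewrite addrC addrA subrK.
exists Q, (q' * N)%N, (q' * K + q' * (q * Kbad))%N; split=> [|x]; first by rewrite muln_gt0 q'0.
have few1 := few_ex (iota 0 q') (P := fun i t => big x (t + ((i * q)%N%:Z - Q%:Z))) (K := K) (fun i => few_shift _ (hK x)).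
have few2 := few_ex (iota 0 q') (P := fun i t => exists2 j, j \in iota 0 q &
   bad x (t + ((i * q)%N%:Z + (j * q')%N%:Z - Q%:Z))) (K := size (iota 0 q) * Kbad)
   (fun i => few_ex (iota 0 q) (fun j => few_shift _ (few_bad x))).
rewrite !size_iota in few1 few2.
apply: few_sub (few_or few1 few2) => t; apply: contra_notP => /not_orP[n1 n2].
have gt : f (x, t) - f (x, t - Q%:Z) = g x (t - Q%:Z) by rewrite /g subrK.
rewrite -/(g x t) gt; split.
  rewrite gE; apply: le_trans (ler_norm_sum _ _ _) _.
  apply: le_trans (_ : \sum_(i < q') N%:Z <= _); last by rewrite sumr_const card_ord; lia.
  apply: ler_sum => i _; rewrite leNgt; apply/negP => hi; apply: n1.
  exists (val i); first by rewrite mem_iota ltn_ord.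
  by rewrite /big addrA addrAC.
rewrite !gE; apply: eq_bigr => i _.
have step j : (j <= q)%N -> h x (t - Q%:Z + (i * q)%N%:Z) = h x (t - Q%:Z + (i * q)%N%:Z + (j * q')%N%:Z).
  elim: j => [|j IH] jq; first by rewrite mul0n addr0.
  rewrite IH ?(ltnW jq)//.
  have nb : ~ bad x (t + ((i * q)%N%:Z + (j * q')%N%:Z - Q%:Z)).
    move=> hb; apply: n2; exists (val i); first by rewrite mem_iota ltn_ord.
    by exists j; rewrite ?mem_iota.
  have := contrapT nb; rewrite (_ : t + _ = t - Q%:Z + (i * q)%N%:Z + (j * q')%N%:Z); last by ring.
  by move=> ->; congr (h x _); rewrite mulSn PoszD; ring.
rewrite (step q (leqnn _)); congr (h x _); rewrite /Q mulnC; ring.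
Qed.

End Unpatterned.

Lemma few_min K (P : int -> Prop) : few K P -> (exists y, P y) ->
  exists2 r, P r & forall y, P y -> r <= y.
Proof.
move=> [s _ hs] [y0 Py0]; pose b : int := - (\sum_(y <- s) `|y|)%N%:Z.
have hb y : P y -> b <= y.
  move=> /hs ys; have : (`|y| <= \sum_(y <- s) `|y|)%N by rewrite (big_rem y)//= leq_addr.
  by rewrite /b; lia.
have ex : exists n : nat, `[< P (b + n%:Z) >].
  exists `|(y0 - b)%R|%N; apply/asboolP.
  by rewrite gez0_abs ?subr_ge0 ?hb// addrC subrK.
have [n /asboolP Pn nmin] := ex_minnP ex; exists (b + n%:Z) => // y Py.
have := nmin `|(y - b)%R|%N; rewrite gez0_abs ?subr_ge0 ?hb// addrC subrK asboolT// => /(_ isT).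
by have := hb y Py; lia.
Qed.

Section Taming.
Variables (L : language) (S : structure L int) (addS : has_add S) (ltS : has_lt S).

Definition tame X {cX : Ctx X} :=
  forall f : X -> int, dfun S f -> dfun Presburger f.

Lemma dpred_tame X (cX : Ctx X) (P : X -> Prop) :
  tame -> dpred S P -> dpred Presburger P.
Proof.
move=> tX dP; pose chi x : int := if `[< P x >] then 1 else 0.
have dchi : dfun S chi.
  apply: eq_dpred (dpred_or (dpred_and (dpred_pull (g := @fst X int) _ dP)
      (dpred_eq (f := snd) (dfun_last _ _) (dfun_cst _ _ 1)))
    (dpred_and (dpred_pull (g := @fst X int) _ (dpred_not dP))
      (dpred_eq (f := snd) (dfun_last _ _) (dfun_cst _ _ 0)))) => [[x y]|v hv|v hv] /=.
  - by rewrite /chi; case: asboolP; tauto.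
  - by left; left; exists v.
  - by left; left; exists v.
apply: eq_dpred (dpred_eq (tX _ dchi) (dfun_cst _ _ 1)) => x.
by rewrite /chi; case: asboolP.
Qed.

Lemma few_tame X (cX : Ctx X) (R : X * int -> Prop) (g : X * int -> int) K :
  @tame X cX -> dpred S R -> (forall x, few K (fun y => R (x, y))) -> dfun S g ->
  dpred Presburger (fun z : X * int * int => R z.1 /\ z.2 = g z.1).
Proof.
move=> tX + + dg; elim: K R => [|K IH] R dR hR.
  apply: eq_dpred dpred_false => -[[x y] z]; split=> // -[Rxy _].
  by have [[|//] _ /(_ y Rxy)] := hR x.
pose D x := exists y, R (x, y).
have dD : dpred S D.
  apply: dpred_ex; apply: (dpred_pull _ dR) => v [[u hu ->]|[u -> ->]]; left.
    by left; exists u.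
  by right; exists id.
pose isr x y := R (x, y) /\ forall y', R (x, y') -> y <= y'.
have /choice[r hr] x : exists y, (D x -> isr x y) /\ (~ D x -> y = 0).
  have [Dx|nDx] := EM (D x); last by exists 0.
  by have [y Ry hy] := few_min (hR x) Dx; exists y.
have disr : dpred S (fun z : X * int => isr z.1 z.2).
  apply: dpred_and; first by apply: eq_dpred dR => -[].
  apply: dpred_all; apply: dpred_imp; last by apply: (dpred_le ltS); dproj.
  apply: (dpred_subst (g := fun z : X * int * int => (z.1.1, z.2))) dR => v [[u hu ->]|[u -> ->]] /=; dproj.
  exact: dfun_var.
have dr : dfun S r.
  apply: eq_dpred (dpred_or (dpred_and (dpred_pull (g := @fst X int) _ dD) disr)
    (dpred_and (dpred_pull (g := @fst X int) _ (dpred_not dD))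
      (dpred_eq (f := snd) (dfun_last _ _) (dfun_cst _ _ 0)))) => [[x y]|v hv|v hv] /=.
  - have [h1 h2] := hr x; have [Dx|nDx] := EM (D x); last by rewrite h2//; tauto.
    have [Rr rmin] := h1 Dx; split=> [[[_ [Ry ymin]]|[]//]|->]; last by left.
    by apply/eqP; rewrite eq_le rmin// ymin.
  - by left; left; exists v.
  - by left; left; exists v.
have dgr : dfun S (fun x => g (x, r x)).
  apply: (dfun_subst (g := fun x => (x, r x))) dg => v [[u hu ->]|[u -> ->]] //=.
  exact: dfun_var.
pose R' (z : X * int) := R z /\ z.2 <> r z.1.
have dR' : dpred S R'.
  by apply: dpred_and => //; apply: dpred_not; apply: dpred_eq; [dproj|exact: dfun_dom].
have hR' x : few K (fun y => R' (x, y)).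
  have [s sK hs] := hR x.
  have [Dx|nDx] := EM (D x); last by exists [::] => // y [Ry]; case: nDx; exists y.
  have [Rr rmin] := (hr x).1 Dx.
  exists (rem (r x) s) => [|y [Ry /eqP yr]].
    by rewrite size_rem ?hs//; case: (s) sK.
  by have := hs y Ry; rewrite (perm_mem (perm_to_rem (hs _ Rr))) inE (negbTE yr).
have dPr := dpred_tame tX dD.
have tr := tX _ dr; have tgr := tX _ dgr.
apply: eq_dpred (dpred_or (dpred_and (dpred_pull (g := fun z : X * int * int => z.1.1) _ dPr)
   (dpred_and (dpred_eq (f := fun z : X * int * int => z.1.2) (g := fun z => r z.1.1) _ _)
              (dpred_eq (f := fun z : X * int * int => z.2) (g := fun z => g (z.1.1, r z.1.1)) _ _)))
   (IH R' dR' hR')) => [[[x b] v]|v hv||||] /=.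
- split=> [[[Dx [-> ->]]|[[? _] ->]]|[Rxb ->]] //.
    by split=> //; case: ((hr x).1 Dx).
  have [bE|br] := EM (b = r x); last by right.
  by left; split; [exists b|rewrite -bE].
- by left; left; exists (fun z => v z.1) => //; left; exists v.
- by dproj.
- by dproj.
- by dproj.
- by dproj.
Qed.

Lemma arithmetic_run (f : int -> int) (Q N : int) (b : int) (k : nat) :
  (forall j : nat, (0 < j)%N -> (j <= k)%N ->
     `|f (b + Q * j%:Z) - f (b + Q * j%:Z - Q)| <= N /\
     f (b + Q * j%:Z + Q) - f (b + Q * j%:Z) = f (b + Q * j%:Z) - f (b + Q * j%:Z - Q)) ->
  f (b + Q * k%:Z) = f b + (f (b + Q) - f b) * k%:Z /\
  ((0 < k)%N -> `|f (b + Q) - f b| <= N).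
Proof.
move=> h.
have E j : b + Q * j.+1%:Z - Q = b + Q * j%:Z by rewrite intS; lia.
have E' j : b + Q * j%:Z + Q = b + Q * j.+1%:Z by rewrite intS; lia.
have slope j : (j <= k)%N -> f (b + Q * j.+1%:Z) - f (b + Q * j%:Z) = f (b + Q) - f b.
  elim: j => [|j IH] jk; first by rewrite mulr1 mulr0 addr0.
  by have [_] := h j.+1 isT jk; rewrite E' E => ->; apply: IH; exact: ltnW.
split; last by move=> k0; have [+ _] := h 1%N isT k0; rewrite E mulr1 mulr0 addr0.
elim: (k) slope => [|i IH] slope; first by rewrite !mulr0 !addr0.
have := slope i (leqnSn i); rewrite IH => [|j ji]; last by apply: slope; exact: leqW.
by move=> /eqP; rewrite subr_eq => /eqP ->; rewrite intS mulrDr mulr1 addrCA.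
Qed.

Hypothesis noS : ~ patterned S.

Lemma tame_half X (cX : Ctx X) (f : X * int -> int) : @tame X cX -> dfun S f ->
  dpred Presburger (fun z : X * int * int => 0 <= z.1.2 /\ z.2 = f z.1).
Proof.
move=> tX df; have [Q [N [K [Q0 hK]]]] := few_nonlinear addS ltS noS df.
pose reg (z : X * int) := `|f z - f (z.1, z.2 - Q%:Z)| <= N%:Z /\
      f (z.1, z.2 + Q%:Z) - f z = f z - f (z.1, z.2 - Q%:Z).
pose E z := ~ reg z \/ (0 <= z.2 /\ z.2 < Q%:Z).
have dshift (c : int) : dfun S (fun z : X * int => f (z.1, z.2 + c)).
  apply: (dfun_subst (g := fun z : X * int => (z.1, z.2 + c))) df => v [[u hu ->]|[u -> ->]] /=.
    by dproj; exact: dfun_var.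
  by apply: (dfunD addS); [dproj|exact: dfun_cst].
have dE : dpred S E.
  apply: dpred_or; last first.
    by apply: dpred_and; [apply: (dpred_le ltS)|apply: (dpred_lt ltS)]; dproj; exact: dfun_cst.
  apply: dpred_not; apply: dpred_and.
    by apply: (dpred_near addS ltS); [|exact: dshift|exact: dfun_cst].
  by apply: dpred_eq; apply: (dfunB addS) => //; exact: dshift.
have fewE x : few (K + size [seq i%:Z | i <- iota 0 Q]) (fun b => E (x, b)).
  apply: few_or (hK x) _; apply: few_sub (few_seq _) => t [/= t0 tQ].
  by apply/mapP; exists `|t|%N; [rewrite mem_iota; lia|rewrite gez0_abs].
have d0 := few_tame tX dE fewE df.
have d1 := few_tame tX dE fewE (dshift Q%:Z).
have dPE : dpred Presburger E.
  apply: eq_dpred (dpred_ex (P := fun z v => E z /\ v = f z) d0) => z.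
  by split=> [[v []]//|Ez]; exists (f z).
pose rng := [seq i%:Z - N%:Z | i <- iota 0 (N + N).+1].
have addP := has_add_Presburger; have ltP := has_lt_Presburger.
apply: eq_dpred (dpred_and (dpred_le ltP (f := fun=> 0) (g := fun z : X * int * int => z.1.2) _ _)
  (dpred_ex (P := fun z b => exists v0 v1 k, (E (z.1.1, b) /\ v0 = f (z.1.1, b)) /\
    (E (z.1.1, b) /\ v1 = f (z.1.1, b + Q%:Z)) /\ 0 <= k /\ z.1.2 = b + Q%:Z * k /\
    (forall j, 0 < j -> j <= k -> ~ E (z.1.1, b + Q%:Z * j)) /\
    ((k = 0 /\ z.2 = v0) \/ exists2 s, s \in rng & v1 - v0 = s /\ z.2 = v0 + s * k)) _)) => [[[x t] y]|||] /=.
- split=> [[t0 [b [v0 [v1 [k [[_ ->] [[_ ->] [k0 [tE [hE hy]]]]]]]]]]|[t0 ->]].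
    split=> //; have kE : k = `|k|%N by rewrite gez0_abs.
    have [fk _] := @arithmetic_run (fun c => f (x, c)) Q%:Z N%:Z b `|k|%N (fun j j0 jk =>
      contrapT (fun nr => hE j%:Z j0 (ltac:(lia)) (or_introl nr))).
    rewrite -kE in fk; rewrite tE fk.
    by case: hy => [[-> ->]|[s _ [<- ->]]]; rewrite ?mulr0 ?addr0.
  split=> //.
  have ex : exists k : nat, `[< E (x, t - Q%:Z * k%:Z) >].
    exists `|(t %/ Q%:Z)%Z|%N; apply/asboolP; right => /=.
    rewrite gez0_abs ?divz_ge0// [Q%:Z * _]mulrC -[t - _]/(t %% Q%:Z)%Z.
    by rewrite modz_ge0 ?ltz_pmod// -lt0n.
  have [k /asboolP Ek kmin] := ex_minnP ex.
  pose b := t - Q%:Z * k%:Z.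
  have tE : t = b + Q%:Z * k%:Z by rewrite subrK.
  have hE j : (0 < j)%N -> (j <= k)%N -> ~ E (x, b + Q%:Z * j%:Z).
    move=> j0 jk Ej; have : (k <= k - j)%N; last lia.
    apply: kmin; apply/asboolP.
    by rewrite (_ : t - _ = b + Q%:Z * j%:Z)// -subzn// tE; ring.
  have [fk fN] := @arithmetic_run (fun c => f (x, c)) Q%:Z N%:Z b k (fun j j0 jk =>
      contrapT (fun nr => hE j j0 jk (or_introl nr))).
  exists b, (f (x, b)), (f (x, b + Q%:Z)), k%:Z; do 2![split=> //]; split=> //; split=> //.
  split.
    move=> j j0 jk; have := hE `|j|%N; rewrite gez0_abs ?(ltW j0)//; apply; lia.
  rewrite tE fk; case: (posnP k) => [->|k0]; first by left; rewrite mulr0 addr0.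
  right; exists (f (x, b + Q%:Z) - f (x, b)) => //.
  move: (_ - _) (fN k0) => c hc; apply/mapP; exists `|(c + N%:Z)%R|%N; last lia.
  by rewrite mem_iota; lia.
- exact: dfun_cst.
- by dproj.
apply: dpred_ex; apply: dpred_ex; apply: dpred_ex.
have dw v : vars v -> dfun Presburger (fun z : X * int * int * int * int * int * int => v z.1.1.1.1.1.1).
  by move=> hv; dproj; exact: dfun_var.
apply: dpred_and.
  apply: (dpred_subst (g := fun z : X * int * int * int * int * int * int =>
    (z.1.1.1.1.1.1, z.1.1.1.2, z.1.1.2))) d0.
  by move=> v [[u [[u' hu' ->]|[u' -> ->]] ->]|[u -> ->]] /=; [exact: dw|dproj|dproj].
apply: dpred_and.
  apply: (dpred_subst (g := fun z : X * int * int * int * int * int * int =>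
    (z.1.1.1.1.1.1, z.1.1.1.2, z.1.2))) d1.
  by move=> v [[u [[u' hu' ->]|[u' -> ->]] ->]|[u -> ->]] /=; [exact: dw|dproj|dproj].
apply: dpred_and; first by apply: (dpred_le ltP); [exact: dfun_cst|dproj].
apply: dpred_and.
  by apply: dpred_eq; [dproj|apply: (dfunD addP); [dproj|apply: (dfunMl addP); dproj]].
apply: dpred_and.
  apply: dpred_all; apply: dpred_imp; first by apply: (dpred_lt ltP); [exact: dfun_cst|dproj].
  apply: dpred_imp; first by apply: (dpred_le ltP); dproj.
  apply: dpred_not.
  apply: (dpred_subst (g := fun z : X * int * int * int * int * int * int * int =>
    (z.1.1.1.1.1.1.1, z.1.1.1.1.2 + Q%:Z * z.2))) dPE.
  move=> v [[u hu ->]|[u -> ->]] /=; first by dproj; exact: dfun_var.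
  by apply: (dfunD addP); [dproj|apply: (dfunMl addP); dproj].
apply: dpred_or; first by apply: dpred_and; apply: dpred_eq; dproj; exact: dfun_cst.
apply: dpred_ex_mem => s; apply: dpred_and; apply: dpred_eq; try by dproj.
- by apply: (dfunB addP); dproj.
- exact: dfun_cst.
- by apply: (dfunD addP); [dproj|apply: (dfunMl addP); dproj].
Qed.

Lemma tame_prod X (cX : Ctx X) : @tame X cX -> @tame (X * int) _.
Proof.
move=> tX f df.
have df' : dfun S (fun z : X * int => f (z.1, - z.2)).
  apply: (dfun_subst (g := fun z : X * int => (z.1, - z.2))) df => v [[u hu ->]|[u -> ->]] /=.
    by dproj; exact: dfun_var.
  by apply: (dfunN addS); dproj.
have h1 := tame_half tX df; have h2 := tame_half tX df'.
apply: eq_dpred (dpred_or h1 (dpred_subst (g := fun z : X * int * int => (z.1.1, - z.1.2, z.2)) _ h2)) => [[[x t] y]|] /=.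
  rewrite opprK; split=> [[[_ ->]|[_ ->]]//|->].
  by have [t0|t0] := lerP 0 t; [left|right; split=> //; rewrite oppr_ge0 ltW].
move=> v [[u [[u' hu' ->]|[u' -> ->]] ->]|[u -> ->]] /=; last by dproj.
  by dproj; exact: dfun_var.
by apply: (dfunN has_add_Presburger); dproj.
Qed.

Lemma tame_tuple n : @tame (n.-tuple int) _.
Proof.
elim: n => [|n IH] f df.
  apply: eq_dpred (dpred_eq (dfun_last _ _) (dfun_cst _ _ (f [tuple]))) => -[e y] /=.
  by rewrite (tuple0 e).
have dg : dfun S (fun z : n.-tuple int * int => f [tuple of z.2 :: z.1]).
  apply: dfun_pull df => v [i ->].
  left; case: (unliftP ord0 i) => [j ->|->].
    by left; exists (fun e => tnth e j); [exists j|apply/funext => z; rewrite tnthS].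
  by right; exists id => //; apply/funext => z; rewrite tnth0.
have := dfun_pull (g := fun e : n.+1.-tuple int => ([tuple of behead e], thead e)) _ (tame_prod IH dg).
rewrite (_ : (fun e => f _) = f); last by apply/funext => e; rewrite -tuple_eta.
apply=> v [[u [i ->] ->]|[u -> ->]] /=; left; last by exists ord0.
by exists (lift ord0 i); apply/funext => e; rewrite [in RHS](tuple_eta e) tnthS.
Qed.

End Taming.

Lemma unpatterned_Presburger L (S : structure L int) :
  has_add S -> has_lt S -> ~ patterned S -> interdefinable S Presburger.
Proof.
move=> addS ltS noS; split=> n A n0 /definable_dpred dA; apply/definable_dpred.
  by apply: dpred_tame dA; exact: (tame_tuple addS ltS noS).
exact: dpred_from_Presburger.
Qed.

Close Scope ring_scope.

Theorem corollary1p4 :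
  (* (a) *)
  (forall (n : nat) (A : set (n.-tuple int)),
     0 < n -> definable Presburger A ->
     definable Zgroup A \/
     (definable (add_rel Zgroup A) Zlt /\
      (forall (m : nat) (B : set (m.-tuple int)),
         0 < m -> definable Presburger B -> definable (add_rel Zgroup A) B)))
  /\
  (* (b) *)
  (forall (L : language) (M : structure L int),
     is_expansion M Zgroup -> stable M ->
     forall (n : nat) (A : set (n.-tuple int)),
       0 < n -> definable M A -> definable Presburger A -> definable Zgroup A)
  /\
  (* (c) *)
  (forall (L : language) (M : structure L int),
     is_expansion M Zgroup -> dp_minimal M \/ strong M ->
     ~ interdefinable M Presburger ->
     forall (n : nat) (A : set (n.-tuple int)),
       0 < n -> definable M A -> definable Presburger A -> definable Zgroup A).
Proof.
split; [|split].
- move=> n A _ /definable_dichotomy[|ltA]; [by left|right].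
  split=> [|m B _ /definable_dpred dB]; apply/definable_dpred; first exact/dpred_Zlt.
  exact: dpred_from_Presburger (has_add_rel A) ltA _ _ _ dB.
- move=> L M expM stM n A _ dMA /(expansion_dichotomy expM dMA)[//|ltM].
  by case: (has_lt_unstable ltM stM).
- move=> L M expM tameM ninter n A _ dMA /(expansion_dichotomy expM dMA)[//|ltM].
  case: ninter; apply: unpatterned_Presburger => //; first exact: has_add_expansion.
  by move=> [inp ict]; case: tameM => [[_ ndp]|nstrong]; [exact: ndp|exact: nstrong].
Qed.
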